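(* Consider the generalized Pólya–Young urn described in the context, with parameters $p\in\mathbb{N}$, $\sigma>0$, $\ell>0$, $w_0>0$, $b_0\ge0$. Then: (i) For all $N\ge0$ and $s\in\mathbb{N}_0$, \[ \mathbb{E}\big(\langle W_N/\sigma\rangle_s\big)=\langle w_0/\sigma\rangle_s\prod_{j=0}^{N-1}\frac{T_j+s\sigma}{T_j}. \] (ii) For all real $v$ with $|v-1|<1$, \[ \mathbb{E}\big(v^{W_N/\sigma}\big)=\sum_{s\ge0}\frac{(v-1)^s}{s!}\sum_{r=0}^{s}(-1)^{s-r}L_{s,r}\,\langle w_0/\sigma\rangle_r\prod_{j=0}^{N-1}\frac{T_j+r\sigma}{T_j}, \] where $L_{s,r}$ are the Lah numbers. (iii) Let $g_N=\prod_{j=0}^{N-1}\frac{T_j}{T_j+\sigma}$. Then $g_N\,N^{\Lambda}\to\kappa$ as $N\to\infty$, where \[ \kappa=p^{\Lambda}\prod_{r=0}^{p-1}\frac{\Gamma\!\left(\frac{r}{\psi}+\frac{w_0+b_0}{\sigma\psi}+\frac1\psi\right)}{\Gamma\!\left(\frac{r}{\psi}+\frac{w_0+b_0}{\sigma\psi}\right)}. \] (iv) $M_N:=g_NW_N$ is a non-negative martingale with respect to $(\mathcal{F}_N)$, it converges almost surely to a limit $M_\infty$, and $W_N/N^{\Lambda}\to M_\infty/\kappa$ almost surely.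
   Context: Generalized Pólya–Young urn: fix $p\in\mathbb{N}$, reals $\sigma>0$, $\ell>0$, and initial amounts $w_0>0$ (white) and $b_0\ge0$ (black); ball amounts are allowed to be real. Let $W_N,B_N$ be the white/black amounts after $N$ steps and $T_N=W_N+B_N$. At step $N\ge1$ a colour is drawn, white with conditional probability $W_{N-1}/T_{N-1}$, black otherwise. If $p\nmid N$, the drawn colour gains $\sigma$ (replacement matrix $\mathrm{diag}(\sigma,\sigma)$). If $p\mid N$, the replacement matrix is $\begin{pmatrix}\sigma&\ell\\0&\sigma+\ell\end{pmatrix}$: if white was drawn, white gains $\sigma$ and black gains $\ell$; if black was drawn, black gains $\sigma+\ell$. Hence for $N=np+k$ with $n\in\mathbb{N}_0$, $0\le k\le p-1$: $T_N=n(p\sigma+\ell)+k\sigma+w_0+b_0$ (deterministic). $\mathcal{F}_N$ is the $\sigma$-field generated by the first $N$ draws. Set $\psi=p+\ell/\sigma$ and $\Lambda=p/\psi=\frac{p}{p+\ell/\sigma}\in(0,1)$. Rising factorials: $\langle x\rangle_s=x(x+1)\cdots(x+s-1)$, $\langle x\rangle_0=1$. Lah numbers: $L_{0,0}=1$, $L_{s,0}=0$ for $s\ge1$, and $L_{s,r}=\binom{s}{r}\frac{(s-1)!}{(r-1)!}$ for $1\le r\le s$. *)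

(* Defs.v *)
From HB Require Import structures.
From mathcomp Require Import all_boot all_order all_algebra.
From mathcomp Require Import all_classical all_reals all_analysis.
Set Implicit Arguments. Unset Strict Implicit. Unset Printing Implicit Defensive.
Import Order.TTheory GRing.Theory Num.Theory.
Local Open Scope classical_set_scope.
Local Open Scope ring_scope.

Definition rising {R : realType} (x : R) (s : nat) : R :=
  \prod_(i < s) (x + i%:R).

Definition lah {R : realType} (s r : nat) : R :=
  if r == 0%N then (s == 0%N)%:R
  else if (r <= s)%N then 'C(s, r)%:R * (s.-1)`!%:R / (r.-1)`!%:R else 0.

Definition Gamma {R : realType} (x : R) : R :=
  fine (\int[@lebesgue_measure R]_(t in `]0, +oo[%classic)
          (powR t (x - 1) * expR (- t))%:E).

(* Pathwise urn dynamics.  h : nat -> bool is the sequence of draws,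
   h n = true meaning white is drawn at step n+1 (steps are numbered from 1). *)
Fixpoint Wpath {R : realType} (sigma w0 : R) (h : nat -> bool) (N : nat) : R :=
  match N with
  | 0 => w0
  | n.+1 => Wpath sigma w0 h n + (if h n then sigma else 0)
  end.

Fixpoint Bpath {R : realType} (p : nat) (sigma ell b0 : R) (h : nat -> bool)
  (N : nat) : R :=
  match N with
  | 0 => b0
  | n.+1 => Bpath p sigma ell b0 h n +
      (if h n then (if (p %| n.+1)%N then ell else 0)
       else (if (p %| n.+1)%N then sigma + ell else sigma))
  end.

Definition Ttot {R : realType} (p : nat) (sigma ell w0 b0 : R) (N : nat) : R :=
  (N %/ p)%N%:R * (p%:R * sigma + ell) + (N %% p)%N%:R * sigma + w0 + b0.

Definition psi {R : realType} (p : nat) (sigma ell : R) : R := p%:R + ell / sigma.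
Definition Lambda {R : realType} (p : nat) (sigma ell : R) : R :=
  p%:R / psi p sigma ell.

Definition gN {R : realType} (p : nat) (sigma ell w0 b0 : R) (N : nat) : R :=
  \prod_(j < N) (Ttot p sigma ell w0 b0 j / (Ttot p sigma ell w0 b0 j + sigma)).

Definition kappa {R : realType} (p : nat) (sigma ell w0 b0 : R) : R :=
  let ps := psi p sigma ell in
  powR p%:R (Lambda p sigma ell) *
  \prod_(r < p) (Gamma (r%:R / ps + (w0 + b0) / (sigma * ps) + 1 / ps)
                 / Gamma (r%:R / ps + (w0 + b0) / (sigma * ps))).

Definition history {d} {Omega : measurableType d} (X : nat -> Omega -> bool)
  (N : nat) (h : nat -> bool) : set Omega :=
  [set w | forall i, (i < N)%N -> X i w = h i].

Definition Fdraws {d} {Omega : measurableType d} (X : nat -> Omega -> bool)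
  (N : nat) : set (set Omega) :=
  <<s setT, [set A | exists i (B : set bool), (i < N)%N /\ A = X i @^-1` B] >>.

(* Main.v *)
(** A path functional of the first [N] draws has expectation given by an explicit
    recursion over the draws, because the conditional law of each draw is a
    function of the past.  One step of the recursion multiplies the rising
    factorial [<W/sigma>_s] by [(T + s sigma) / T]; this gives (i), and the case
    [s = 1] is the martingale property.  For (ii), the binomial series of
    [(1 + (v - 1)) ^ (W/sigma)] is integrated termwise (only finitely many paths
    matter), falling factorials being expanded in rising ones by Lah numbers.
    For (iii), along multiples of [p] the product [g_N] splits by residues into
    [p] products [prod_(n < m) (n + c) / (n + c + 1/psi)], asymptotic to
    [Gamma (c + 1/psi) / Gamma c * m ^ (- 1/psi)] by Wendel's inequality; monotonicity
    of [g] fills the gaps.  For (iv), the case [s = 2] bounds the second moments of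
    the martingale, since [T (T + 2 sigma) <= (T + sigma)^2], and Kolmogorov's
    maximal inequality yields almost sure convergence. *)

Require Import Defs.
From HB Require Import structures.
From mathcomp Require Import all_boot all_order all_algebra.
From mathcomp Require Import all_classical all_reals all_analysis.
From mathcomp Require Import measurable_realfun.
From mathcomp Require Import ring lra zify.
Import Order.TTheory GRing.Theory Num.Theory.
Import numFieldNormedType.Exports.
Local Open Scope classical_set_scope.
Local Open Scope ring_scope.

(** * Path functionals of the draws *)

Definition upd {U : Type} (h : nat -> U) (k : nat) (b : U) : nat -> U :=
  fun i => if i == k then b else h i.

(** The path-side form of measurability with respect to the first [N] draws; [depends_Fdraws] and
    [Fdraws_depends] translate between the two. *)
Definition depends {U V : Type} (N : nat) (F : (nat -> U) -> V) : Prop :=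
  forall h h', (forall i, (i < N)%N -> h i = h' i) -> F h = F h'.

Lemma depends_upd {U V : Type} (N : nat) (F : (nat -> U) -> V) (b : U) :
  depends N.+1 F -> depends N (fun h => F (upd h N b)).
Proof.
move=> dF h h' hh'; apply: dF => i; rewrite ltnS leq_eqVlt /upd.
by case: eqP => //= _ /hh'.
Qed.

Lemma upd_id {U : Type} (h : nat -> U) (k : nat) : upd h k (h k) = h.
Proof. by apply/funext => i; rewrite /upd; case: eqP => // ->. Qed.

(** Such an [F] takes at most [2 ^ N] values; the induction fixes the last draw to each of its two
    outcomes. *)
Lemma depends_bounded {R : realType} (N : nat) (F : (nat -> bool) -> R) :
  depends N F -> exists C, forall h, `|F h| <= C.
Proof.
elim: N F => [|N IH] F dF.
  by exists `|F xpred0| => h; rewrite (dF h xpred0).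
have [C hC] := IH _ (depends_upd N F true dF).
have [D hD] := IH _ (depends_upd N F false dF).
exists (Num.max C D) => h; rewrite le_max.
by case E: (h N); [have := hC h|have := hD h]; rewrite -E upd_id => ->; rewrite ?orbT.
Qed.

(** * Conditional expectation as a finite average over the draws *)

Section conditional_expectation.
Context {R : realType} (q : nat -> (nat -> bool) -> R).

Definition step (N : nat) (F : (nat -> bool) -> R) (h : nat -> bool) : R :=
  q N h * F (upd h N true) + (1 - q N h) * F (upd h N false).

(* [cexp n k F h] is the conditional expectation of [F] given that the first
   [k] draws are those of [h], when [F] depends on the first [k + n] draws. *)
Fixpoint cexp (n k : nat) (F : (nat -> bool) -> R) : (nat -> bool) -> R :=
  match n with 0 => F | n.+1 => step k (cexp n k.+1 F) end.

(** Tower property: [cexp] unfolds at the earliest draw, while inductions on time must average out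
    the latest draw first. *)
Lemma cexpSr n k F : cexp n.+1 k F = cexp n k (step (n + k) F).
Proof.
elim: n k F => [//|n IH] k F;
  change (step k (cexp n.+1 k.+1 F) = cexp n.+1 k (step (n.+1 + k) F)).
by rewrite IH addSnnS.
Qed.

Lemma cexpD n k F G h :
  cexp n k (fun h => F h + G h) h = cexp n k F h + cexp n k G h.
Proof. by elim: n k h => [//|n IH] k h /=; rewrite /step !IH; ring. Qed.

Lemma cexpZ n k a F h : cexp n k (fun h => a * F h) h = a * cexp n k F h.
Proof. by elim: n k h => [//|n IH] k h /=; rewrite /step !IH; ring. Qed.

Lemma cexp_sum n k m (F : nat -> (nat -> bool) -> R) h :
  cexp n k (fun h => \sum_(i < m) F i h) h = \sum_(i < m) cexp n k (F i) h.
Proof.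
elim: m => [|m IH].
  rewrite big_ord0 -[RHS](mul0r (cexp n k (fun=> 0) h)) -cexpZ.
  by congr cexp; apply/funext => h'; rewrite big_ord0 mul0r.
rewrite big_ord_recr /= -IH -cexpD.
by congr cexp; apply/funext => h'; rewrite big_ord_recr.
Qed.

(** The average runs over finitely many paths, so pointwise convergence passes through it. This is
    the termwise integration behind (ii). *)
Lemma cexp_cvg n k (F : nat -> (nat -> bool) -> R) G h :
  (forall h, F i h @[i --> \oo] --> G h) ->
  cexp n k (F i) h @[i --> \oo] --> cexp n k G h.
Proof.
move=> FG; elim: n k h => [//|n IH] k h /=.
by apply: cvgD; apply: cvgM; [exact: cvg_cst|exact: IH|exact: cvg_cst|exact: IH].
Qed.

Lemma cexp_le n k F G h : (forall m h, 0 <= q m h <= 1) ->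
  (forall h, F h <= G h) -> cexp n k F h <= cexp n k G h.
Proof.
move=> q01 FG; elim: n k h => [|n IH] k h /=; first exact: FG.
have /andP[q0 q1] := q01 k h.
by apply: lerD; apply: ler_wpM2l => //; rewrite subr_ge0.
Qed.

End conditional_expectation.

(** * From path functionals to events and integrals *)

Section path_functionals.
Context {R : realType} {d : measure_display} {Omega : measurableType d}.
Context (P : probability Omega R) (X : nat -> Omega -> bool).
Context (mX : forall n, measurable_fun setT (X n)).

Lemma measurable_drawE n b : measurable [set w | X n w = b].
Proof. by have := mX n measurableT [set b] I; rewrite setTI. Qed.

Lemma historyS N h b :
  history X N.+1 (upd h N b) = history X N h `&` [set w | X N w = b].
Proof.
apply/seteqP; split=> w /=.
  move=> H; split=> [i iN|]; last by rewrite H// /upd eqxx.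
  by rewrite H ?(leq_trans iN)// /upd ltn_eqF.
move=> [H Hb] i; rewrite ltnS leq_eqVlt /upd.
by case: eqP => [->//|_ /= /H].
Qed.

Lemma historyU N h :
  history X N h = history X N.+1 (upd h N true) `|` history X N.+1 (upd h N false).
Proof.
rewrite !historyS -setIUr; apply/seteqP; split=> w; last by case.
by move=> H; split=> //=; case: (X N w); [left|right].
Qed.

Lemma measurable_history N h : measurable (history X N h).
Proof.
elim: N h => [|N IH] h.
  by have -> : history X 0 h = setT by apply/seteqP; split.
rewrite -(upd_id h N) historyS; apply: measurableI => //; exact: measurable_drawE.
Qed.

Lemma Fdraws_measurable N A : Fdraws X N A -> measurable A.
Proof.
apply: smallest_sub A; first exact: sigma_algebra_measurable.
move=> _ [i [B [_ ->]]]; rewrite -[X in measurable X]setTI; exact: mX.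
Qed.

Lemma sigma_algebra_Fdraws N : sigma_algebra setT (Fdraws X N).
Proof. exact: smallest_sigma_algebra. Qed.

Lemma depends_Fdraws N (a : (nat -> bool) -> Prop) :
  depends N a -> Fdraws X N [set w | a (X ^~ w)].
Proof.
(* [spl n h w] follows the draws of [w] before time [n] and the fixed path [h] afterwards. Raising
   [n] by one splits the event by the value of [X n], with both values written into [h]. *)
move=> da; pose spl n h w := fun i => if (i < n)%N then X i w else h i.
suff H n h : (n <= N)%N -> Fdraws X N [set w | a (spl n h w)].
  have -> : [set w | a (X ^~ w)] = [set w | a (spl N xpred0 w)].
    by apply/seteqP; split=> w /=; rewrite (da _ (spl N xpred0 w))// => i iN;
      rewrite /spl iN.
  exact: H.
have [F0 FC FU] := sigma_algebra_Fdraws N.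
have FT : Fdraws X N setT by have := FC _ F0; rewrite setD0.
have Fu A B : Fdraws X N A -> Fdraws X N B -> Fdraws X N (A `|` B).
  by move=> FA FB; rewrite -bigcup2E; apply: FU => -[|[|n0]].
have Fi A B : Fdraws X N A -> Fdraws X N B -> Fdraws X N (A `&` B).
  move=> FA FB; have := FC _ (Fu _ _ (FC _ FA) (FC _ FB)).
  by rewrite !setTD setCU !setCK.
elim: n h => [|n IH] h nN.
  have [ah|nah] := pselect (a h).
    by have -> : [set w | a (spl 0%N h w)] = setT by apply/seteqP; split.
  by have -> : [set w | a (spl 0%N h w)] = set0 by apply/seteqP; split.
have FX b : Fdraws X N [set w | X n w = b].
  by apply: sub_sigma_algebra; exists n, [set b].
have -> : [set w | a (spl n.+1 h w)] =
   ([set w | X n w = true] `&` [set w | a (spl n (upd h n true) w)]) `|`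
   ([set w | X n w = false] `&` [set w | a (spl n (upd h n false) w)]).
  have E w : spl n.+1 h w = spl n (upd h n (X n w)) w.
    apply/funext => i; rewrite /spl /upd ltnS; case: ltngtP => // ->; by rewrite ?eqxx.
  apply/seteqP; split=> w /=; rewrite E.
    by case: (X n w); [left|right].
  by move=> [[-> //]|[-> //]].
by apply: (Fu); apply: (Fi) => //; apply: IH; apply: ltnW.
Qed.

(** No generator separates two outcomes with the same first [N] draws, and the operations of a
    sigma-algebra preserve this saturation. *)
Lemma Fdraws_depends N A : Fdraws X N A ->
  exists2 a : (nat -> bool) -> Prop, depends N a & A = [set w | a (X ^~ w)].
Proof.
move=> FA.
have H : forall w w', (forall i, (i < N)%N -> X i w = X i w') -> A w -> A w'.
  move: A FA; apply: smallest_sub.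
    split=> [//|A HA w w' E [_ nA]|A HA w w' E [n _ An]].
      by split=> // Aw'; apply: nA; apply: HA Aw' => i iN; rewrite E.
    by exists n => //; apply: HA An.
  by move=> _ [i [B [iN ->]]] w w' E /=; rewrite E.
(* The predicate must be defined on all paths, including those that no outcome realises, hence the
   existential over outcomes. *)
exists (fun h => exists2 w, A w & forall i, (i < N)%N -> X i w = h i).
  move=> h h' hh'; apply/propext.
  by split=> -[w Aw E]; exists w => // i iN; rewrite E// hh'.
apply/seteqP; split=> w /=; first by exists w.
by move=> [w' Aw' E]; apply: H Aw'.
Qed.

Lemma measurable_path {N} {F : (nat -> bool) -> R} :
  depends N F -> measurable_fun setT (fun w => F (X ^~ w)).
Proof.
move=> dF _ B mB; rewrite setTI.
apply: (@Fdraws_measurable N); apply: (depends_Fdraws _ (fun h => B (F h))).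
by move=> h h' hh'; rewrite (dF h h').
Qed.

Lemma integrable_path {N} {F : (nat -> bool) -> R} (A : set Omega) :
  measurable A -> depends N F -> P.-integrable A (EFin \o (fun w => F (X ^~ w))).
Proof.
move=> mA dF; apply: measurable_bounded_integrable => //.
- by rewrite (le_lt_trans (probability_le1 P mA)) ?ltry.
- by apply: measurable_funTS; apply: measurable_path dF.
- have [C hC] := depends_bounded _ _ dF.
  by exists C; split; [exact: num_real|move=> M CM w _ /=;
    exact: le_trans (hC _) (ltW CM)].
Qed.

Context (q : nat -> (nat -> bool) -> R).
Context (Pq : forall N h, P (history X N h `&` [set w | X N w = true]) =
  (P (history X N h) * (q N h)%:E)%E).

Lemma Pq_false N h : P (history X N h `&` [set w | X N w = false]) =
  (P (history X N h) * (1 - q N h)%:E)%E.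
Proof.
have mH b : measurable (history X N h `&` [set w | X N w = b]).
  by apply: measurableI; [exact: measurable_history|exact: measurable_drawE].
have E : P (history X N h) = (P (history X N h `&` [set w | X N w = true]) +
    P (history X N h `&` [set w | X N w = false]))%E.
  rewrite {1}historyU !historyS measureU//.
  by apply/seteqP; split=> // w [[_ /= ->] [_ /=]].
rewrite Pq in E.
have fH : P (history X N h) \is a fin_num.
  by apply: fin_num_measure; exact: measurable_history.
have fH' : P (history X N h `&` [set w | X N w = false]) \is a fin_num.
  exact: fin_num_measure.
move: E; rewrite -(fineK fH) -(fineK fH') -!EFinM -EFinD => -[E].
by congr EFin; lra.
Qed.

(** Induction on the number of draws left to average: the cylinder splits by draw [k], and the law
    of that draw merges the two pieces into one [step]. Nothing is divided by the probability of the
    cylinder, so null cylinders are covered. *)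
Lemma integral_history n k F h : depends (n + k) F ->
  (\int[P]_(w in history X k h) (F (X ^~ w))%:E)%E =
  (P (history X k h) * (cexp q n k F h)%:E)%E.
Proof.
elim: n k h => [|n IH] k h dF.
  rewrite (eq_integral (cst (F h)%:E)) => [|w]; last first.
    by rewrite inE => Hw; rewrite (dF _ h).
  by rewrite integral_cst 1?muleC//; exact: measurable_history.
rewrite {1}historyU integral_setU_EFin; last 4 first.
- exact: measurable_history.
- exact: measurable_history.
- by apply: measurable_funTS; exact: (measurable_path dF).
- rewrite !historyS; apply/disj_set2P/seteqP; split=> // w [[_ /= ->] [_ /=]] //.
rewrite !IH ?addnS -?addSn// !historyS Pq Pq_false /= -!muleA -!EFinM.
rewrite -muleDr// ?fin_num_adde_defl//.
by apply: fin_num_measure; exact: measurable_history.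
Qed.

Lemma integral_path N F : depends N F ->
  (\int[P]_w (F (X ^~ w))%:E)%E = (cexp q N 0 F xpred0)%:E.
Proof.
move=> dF; have H0 : history X 0 xpred0 = setT by apply/seteqP; split.
by rewrite -H0 (integral_history N) ?addn0// H0 probability_setT mul1e.
Qed.

End path_functionals.

(** * Martingales bounded in the second moment *)

Section square_bounded_martingale.
Context {R : realType} {d : measure_display} {Omega : measurableType d}.
Context (P : probability Omega R) (X : nat -> Omega -> bool).
Context (mX : forall n, measurable_fun setT (X n)).
Context (q : nat -> (nat -> bool) -> R).
Context (Pq : forall N h, P (history X N h `&` [set w | X N w = true]) =
  (P (history X N h) * (q N h)%:E)%E).
Context (q01 : forall N h, 0 <= q N h <= 1).
Context (m : nat -> (nat -> bool) -> R).
Context (dm : forall N, depends N (m N)).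
Context (martm : forall N h, step q N (m N.+1) h = m N h).

Local Notation Ex N F := (cexp q N 0 F xpred0).

Lemma integral_Ex N F : depends N F -> (\int[P]_w (F (X ^~ w))%:E)%E = (Ex N F)%:E.
Proof. by move=> dF; apply: integral_path. Qed.

Let incr2 N h := (m N.+1 h - m N h) ^+ 2.

(** Pythagoras for martingale increments: the cross term has conditional mean zero. *)
Lemma Ex_sqrS N :
  Ex N.+1 (fun h => m N.+1 h ^+ 2) =
  Ex N (fun h => m N h ^+ 2) + Ex N.+1 (incr2 N).
Proof.
rewrite !cexpSr addn0 -cexpD; congr cexp; apply/funext => h.
have := martm N h; rewrite /step /incr2.
have E b : m N (upd h N b) = m N h.
  by apply: dm => i iN; rewrite /upd ltn_eqF.
by rewrite !E => <-; ring.
Qed.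

Lemma Ex_incr2_ge0 N : 0 <= Ex N.+1 (incr2 N).
Proof.
rewrite -[0](mul0r (Ex N.+1 (incr2 N))) -cexpZ; apply: cexp_le => // h.
by rewrite mul0r sqr_ge0.
Qed.

(* The increment of [m] after time [k], frozen once it leaves [[-eps, eps]]:
   Chebyshev's inequality for this process is Kolmogorov's maximal inequality
   for [m]. *)
Fixpoint stopped (eps : R) (k i : nat) (h : nat -> bool) : R :=
  match i with
  | 0 => 0
  | i.+1 => stopped eps k i h +
      (if `|stopped eps k i h| <= eps then m (k + i).+1 h - m (k + i) h else 0)
  end.

Lemma stopped_depends eps k i : depends (k + i) (stopped eps k i).
Proof.
elim: i => [//|i IH] h h' hh' /=; rewrite addnS in hh'.
have hh := fun j (ij : (j < k + i)%N) => hh' j (ltnW ij).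
by rewrite (IH _ _ hh) (dm _ _ _ hh') (dm _ _ _ hh).
Qed.

Lemma stopped_eq eps k i h : (forall j, (j <= i)%N -> `|stopped eps k j h| <= eps) ->
  stopped eps k i h = m (k + i) h - m k h.
Proof.
elim: i => [|i IH] H /=; first by rewrite addn0 subrr.
by rewrite H// IH ?addnS; [ring|move=> j ji; apply: H; exact: leqW].
Qed.

(** Beyond the threshold the process is frozen, so the escape events increase with time and their
    probabilities converge to that of their union. *)
Lemma stopped_leq eps k i j h : (i <= j)%N ->
  eps < `|stopped eps k i h| -> eps < `|stopped eps k j h|.
Proof.
move=> /subnKC <- H; elim: (j - i)%N => [|n IH]; first by rewrite addn0.
by rewrite addnS /= [`|_| <= eps]leNgt IH addr0.
Qed.

(** Freezing only discards increments, and each increment adds a non-negative amount to the second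
    moment. *)
Lemma Ex_stopped eps k i : Ex (k + i) (fun h => stopped eps k i h ^+ 2) <=
  Ex (k + i) (fun h => m (k + i) h ^+ 2) - Ex k (fun h => m k h ^+ 2).
Proof.
elim: i => [|i IH].
  rewrite addn0 subrr -[X in _ <= X](mul0r (Ex k (fun=> 0))) -cexpZ.
  by apply: cexp_le => // h; rewrite mul0r expr0n.
rewrite addnS Ex_sqrS addrAC; apply: le_trans (lerD IH (lexx _)).
rewrite !cexpSr addn0 -cexpD; apply: cexp_le => // h.
set N := (k + i)%N; rewrite /step /=.
have Es b : stopped eps k i (upd h N b) = stopped eps k i h.
  by apply: stopped_depends => j jN; rewrite /upd ltn_eqF.
have Em b : m N (upd h N b) = m N h.
  by apply: dm => j jN; rewrite /upd ltn_eqF.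
rewrite /incr2 !Es !Em; have := martm N h; rewrite /step.
have /andP[q0 q1] := q01 N h; rewrite -subr_ge0 in q1.
case: ifP => _ E; last first.
  rewrite !addr0 [X in X <= _](_ : _ = stopped eps k i h ^+ 2); last by ring.
  by rewrite lerDl addr_ge0// mulr_ge0// sqr_ge0.
rewrite le_eqVlt; apply/orP; left; apply/eqP.
rewrite -E; ring.
Qed.

Let e N := Ex N (fun h => m N h ^+ 2).

Definition escape (eps : R) k i : set Omega :=
  [set w | is_true (eps < `|stopped eps k i (X ^~ w)|)%R].

Lemma measurable_escape (eps : R) k i : measurable (escape eps k i).
Proof.
apply: (Fdraws_measurable X mX (k + i)).
apply: (depends_Fdraws X _ (fun h => eps < `|stopped eps k i h|)) => h h' hh'.
by rewrite (stopped_depends eps k i h h').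
Qed.

Lemma stopped_chebyshev (eps : R) k i : 0 < eps ->
  (P (escape eps k i) <= ((e (k + i) - e k) / eps ^+ 2)%:E)%E.
Proof.
move=> eps0; set A := escape eps k i; have mA : measurable A by exact: measurable_escape.
pose a h : R := (eps < `|stopped eps k i h|)%R%:R.
have da : depends (k + i) a.
  by move=> h h' hh'; rewrite /a (stopped_depends eps k i h h').
have -> : P A = (Ex (k + i) a)%:E.
  rewrite -integral_Ex// -[A]setIT -integral_indic//; apply: eq_integral => w _.
  rewrite /a indicE; suff -> : (w \in A) = (eps < `|stopped eps k i (X ^~ w)|) by [].
  by apply/idP/idP => H; rewrite inE in H *.
rewrite lee_fin ler_pdivlMr ?exprn_gt0// mulrC -cexpZ.
apply: le_trans (Ex_stopped eps k i); apply: cexp_le => // h; rewrite /a.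
case: (ltP eps `|stopped eps k i h|) => H; last by rewrite mulr0 sqr_ge0.
by rewrite mulr1 -[leRHS]real_normK ?num_real// lerXn2r ?nnegrE ?(ltW eps0)// ltW.
Qed.

Context (K : R).
Context (eK : forall N, e N <= K).

Lemma second_moment_ndecr : {homo e : M N / (M <= N)%N >-> M <= N}.
Proof.
move=> M N /subnKC <-; elim: (N - M)%N => [|n IH]; first by rewrite addn0.
by rewrite addnS (le_trans IH)// /e Ex_sqrS lerDl Ex_incr2_ge0.
Qed.

(** The second moments increase to a finite [L], so the probability of ever escaping after time [k]
    is at most [(L - e k) / eps ^+ 2], which tends to 0 in [k]. *)
Lemma escape_negligible (eps : R) : 0 < eps ->
  P.-negligible (\bigcap_k \bigcup_i escape eps k i).
Proof.
move=> eps0.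
pose A k i := escape eps k i.
have mA k i : measurable (A k i) by exact: measurable_escape.
have mB k : measurable (\bigcup_i A k i) by exact: bigcupT_measurable.
have mC : measurable (\bigcap_k \bigcup_i A k i) by exact: bigcapT_measurable.
have eub : has_ubound (range e) by exists K => _ [N _ <-].
have ce := nondecreasing_cvgn second_moment_ndecr eub; set L := sup _ in ce.
have EL : limn e = L by exact: (cvg_lim (@Rhausdorff R) ce).
have eL N : e N <= L.
  by rewrite -EL; apply: nondecreasing_cvgn_le; [exact: second_moment_ndecr|apply/cvg_ex;
    exists L].
have PB k : (P (\bigcup_i A k i) <= ((L - e k) / eps ^+ 2)%:E)%E.
  have cA : (P \o A k) x @[x --> \oo] --> P (\bigcup_i A k i).
    apply: nondecreasing_cvg_mu => // i j ij; apply/subsetPset => w /=.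
    exact: stopped_leq.
  rewrite -(cvg_lim _ cA)//; apply: lime_le; first by apply/cvg_ex; eexists; exact: cA.
  apply: nearW => i /=; apply: (le_trans (stopped_chebyshev eps k i eps0)).
  by rewrite lee_fin ler_pM2r ?invr_gt0 ?exprn_gt0// lerB.
exists (\bigcap_k \bigcup_i A k i); split => //.
apply/eqP; rewrite eq_le measure_ge0 andbT.
apply/lee_addgt0Pr => t t0; rewrite add0e.
have te : 0 < t * eps ^+ 2 by rewrite mulr_gt0 ?exprn_gt0.
have /cvgrPdist_le/(_ _ te)[k _ Hk] := ce.
have PBk := le_trans (PB k) (_ : _ <= t%:E)%E.
apply: le_trans (PBk _); last first.
  rewrite lee_fin ler_pdivrMr ?exprn_gt0//.
  exact: le_trans (ler_norm _) (Hk k (leqnn k)).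
by apply: le_measure; rewrite ?inE// => w; apply.
Qed.

Lemma square_bounded_martingale_cvg :
  {ae P, forall w, cvgn (fun N => m N (X ^~ w))}.
Proof.
(* Countably many thresholds [1 / (j + 1)] suffice: off all the [C j], for each [j] some time [k]
   exists after which the path stays within [1 / (j + 1)] of [m k], so it is Cauchy. *)
pose C j := \bigcap_k \bigcup_i escape j.+1%:R^-1 k i.
apply: (@negligibleS _ _ _ _ (\bigcup_j C j)); last first.
  by apply: negligible_bigcup => j; apply: escape_negligible; rewrite invr_gt0.
move=> w /= ncv; apply: contrapT => nC; apply: ncv.
apply/cauchy_cvgP/cauchy_exP => t t0.
have [j jt] : exists j : nat, j.+1%:R^-1 < t.
  exists (Num.truncn t^-1); rewrite -[ltRHS]invrK ltf_pV2 ?posrE ?invr_gt0//.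
  by rewrite truncnS_gt.
have : ~ C j w by move=> Cw; apply: nC; exists j.
rewrite /C /bigcap /= => /existsNP[k] /not_implyP[_ H].
exists (m k (X ^~ w)); exists k => // N /= kN; rewrite /ball /= distrC.
have Hk i : `|stopped j.+1%:R^-1 k i (X ^~ w)| <= j.+1%:R^-1.
  by rewrite leNgt; apply/negP => H'; apply: H; exists i.
have := stopped_eq j.+1%:R^-1 k (N - k) (X ^~ w) (fun i _ => Hk i).
by rewrite subnKC// => <-; exact: le_lt_trans (Hk _) jt.
Qed.

End square_bounded_martingale.

(** * Lah numbers and the binomial series *)

Section lah_numbers.
Context {R : realType}.
Implicit Types (x : R) (s r n : nat).

Definition falling x s : R := \prod_(i < s) (x - i%:R).

Lemma fallingS x s : falling x s.+1 = falling x s * (x - s%:R).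
Proof. exact: big_ord_recr. Qed.

Lemma risingS x s : rising x s.+1 = rising x s * (x + s%:R).
Proof. exact: big_ord_recr. Qed.

(** Pascal's rule, then [mul_bin_left] to express the higher binomial coefficient by the lower one.
    The cases [s = 0] and [r = 0] are apart because of the predecessors under the factorials and the
    special value at [r = 0]. *)
Lemma lahS s r : lah s.+1 r.+1 = lah s r + (s + r.+1)%:R * lah s r.+1 :> R.
Proof.
have lahE a b : lah a b.+1 = 'C(a, b.+1)%:R * (a.-1)`!%:R / b`!%:R :> R.
  by rewrite /lah /=; case: leqP => // ab; rewrite bin_small// !mul0r.
case: s => [|s].
  case: r => [|r]; first by rewrite !lahE /lah /= fact0 binn bin_small//; field.
  by rewrite !lahE !bin_small//; ring.
case: r => [|r].
  by rewrite !lahE {1}/lah /= !bin1 factS natrM fact0 addn1; field.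
rewrite !lahE !succnK binS.
have /(congr1 (fun n => n%:R : R)) E := mul_bin_left s.+1 r.+1.
rewrite !natrM in E.
have [rs|sr] := leqP r s.
  have {E}E : 'C(s.+1, r.+2)%:R = (s - r)%:R * 'C(s.+1, r.+1)%:R / r.+2%:R :> R.
    have r2 : r.+2%:R != 0 :> R by rewrite pnatr_eq0.
    by apply: (canRL (mulfK r2)); rewrite mulrC E subSS.
  have fr : r`!%:R != 0 :> R by rewrite pnatr_eq0 -lt0n fact_gt0.
  have r0 := ler0n R r.
  move: E; set A := 'C(s.+1, r.+2); set B := 'C(s.+1, r.+1) => E.
  clearbody A B.
  rewrite (factS s) (factS r) !natrM !natrD E natrB//.
  rewrite -!natr1.
  by field; rewrite fr; lra.
have -> : 'C(s.+1, r.+2) = 0%N by rewrite bin_small// ltnS leqW.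
by rewrite bin_small// addn0 !mul0r mulr0 addr0.
Qed.

(** Induction with [x - s = (x + r) - (s + r)]: the first part raises the rising factorial, the
    second is the weight in [lahS]. *)
Lemma falling_lah x s :
  falling x s = \sum_(r < s.+1) (-1) ^+ (s - r) * lah s r * rising x r.
Proof.
(* The exponent [s + r] has the same parity as [s - r] and avoids truncated subtraction. *)
transitivity (\sum_(r < s.+1) (-1) ^+ (s + r) * lah s r * rising x r); last first.
  apply: eq_bigr => r _; congr (_ * _ * _).
  have rs : (r <= s)%N by rewrite -ltnS.
  by rewrite -[LHS]signr_odd -[RHS]signr_odd oddB// oddD.
elim: s => [|s IH].
  by rewrite big_ord_recl big_ord0 /falling /rising /lah !big_ord0 /= ; ring.
rewrite fallingS {}IH.
(* The weighted terms vanish at [0] and at [s.+1], so their sum is unchanged by an index shift. *)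
pose a r := (-1) ^+ (s + r) * (s + r)%:R * lah s r * rising x r.
have a0 : a 0%N = 0 by rewrite /a /lah; case: (s) => [|s']; rewrite mulr0 !mul0r.
have aS : a s.+1 = 0 by rewrite /a /lah /= ltnn mulr0 mul0r.
have sa : \sum_(r < s.+1) a r.+1 = \sum_(r < s.+1) a r.
  have Hl : \sum_(r < s.+2) a r = a 0%N + \sum_(r < s.+1) a r.+1 by exact: big_ord_recl.
  have Hr : \sum_(r < s.+2) a r = \sum_(r < s.+1) a r + a s.+1 by exact: big_ord_recr.
  by rewrite a0 add0r in Hl; rewrite aS addr0 in Hr; rewrite -Hl.
have l0 : lah s.+1 0 = 0 :> R by [].
rewrite [RHS]big_ord_recl /= l0 mulr0 mul0r add0r.
under [RHS]eq_bigr => r _.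
  rewrite /= lahS /bump /= add1n.
  have -> : (-1) ^+ (s.+1 + r.+1) * (lah s r + (s + r.+1)%:R * lah s r.+1) * rising x r.+1
     = (-1) ^+ (s + r) * lah s r * rising x r.+1 - a r.+1 :> R.
    by rewrite /a !addSn !addnS !exprS; ring.
  over.
rewrite sumrB sa -sumrB mulr_suml; apply: eq_bigr => r _.
by rewrite /a risingS natrD; ring.
Qed.

End lah_numbers.

(** * The binomial series for a real exponent *)

Section binomial_series.
Context {R : realType}.
Implicit Types (x t : R) (n : nat).

Definition binc x n : R := falling x n / n`!%:R.

Lemma bincS x n : n.+1%:R * binc x n.+1 = (x - n%:R) * binc x n.
Proof.
rewrite /binc fallingS factS natrM.
have fn : n`!%:R != 0 :> R by rewrite pnatr_eq0 -lt0n fact_gt0.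
by field; rewrite fn nat1r pnatr_eq0.
Qed.

Definition bin_poly x n : {poly R} := \sum_(s < n) binc x s *: 'X^s.

Lemma horner_bin_poly x n t : (bin_poly x n).[t] = \sum_(s < n) binc x s * t ^+ s.
Proof. by rewrite horner_sum; apply: eq_bigr => s _; rewrite !hornerE. Qed.

(* The truncation satisfies the differential equation of [(1 + t) ^ x] up to
   a single monomial. *)
Lemma bin_poly_ode x n t : (1 + t) * ((bin_poly x n.+1)^`()).[t] -
  x * (bin_poly x n.+1).[t] = - (n.+1%:R * binc x n.+1 * t ^+ n).
Proof.
elim: n => [|n IH].
  by rewrite bincS /bin_poly !big_ord1 expr0 alg_polyC derivC !hornerE /=; ring.
rewrite [in RHS]bincS /bin_poly big_ord_recr /= -/(bin_poly x n.+1).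
rewrite derivD derivZ derivXn /= !hornerD !hornerZ hornerMn !hornerXn -mulr_natl.
rewrite -[n.+1%:R]natr1 in IH *; set A := (_^`()).[t] in IH *.
set B := (bin_poly x n.+1).[t] in IH *.
transitivity ((1 + t) * A - x * B + (1 + t) * (binc x n.+1 * ((n%:R + 1) * t ^+ n)) -
    x * (binc x n.+1 * t ^+ n.+1)); first by ring.
by rewrite IH exprS; ring.
Qed.

(** By [bincS], once [n] is at least [x] the sequence is non-increasing; the sum of the initial
    terms bounds the rest. *)
Lemma binc_bounded x : 0 < x ->
  exists C, forall n, n.+1%:R * `|binc x n.+1| <= C.
Proof.
move=> x0; pose d n := n.+1%:R * `|binc x n.+1|.
have [m xm] : exists m : nat, x <= m%:R.
  by exists (Num.truncn x).+1; rewrite ltW// truncnS_gt.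
have dS n : (m <= n)%N -> d n.+1 <= d n.
  move=> mn; have xn : x <= n%:R by rewrite (le_trans xm)// ler_nat.
  rewrite /d -[X in X * _ <= _]ger0_norm// -normrM bincS normrM; apply: ler_wpM2r => //.
  rewrite ler_norml; have := ler0n R n; rewrite -natr1; lra.
exists (\sum_(i < m.+1) d i) => n; rewrite -/(d n).
have d0 i : 0 <= d i by rewrite /d mulr_ge0.
have dle i : (i <= m)%N -> d i <= \sum_(i < m.+1) d i.
  move=> im; rewrite (bigD1 (Ordinal (im : (i < m.+1)%N)))//= lerDl; exact: sumr_ge0.
have [nm|/ltnW/subnKC <-] := leqP n m; first exact: dle.
elim: (n - m)%N => [|k IH]; first by rewrite addn0; exact: dle.
by rewrite addnS (le_trans _ IH)// dS// leq_addr.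
Qed.

(** Mean value theorem for the truncation times [(1 + t) ^ (- x)], which equals 1 at 0; by
    [bin_poly_ode] its derivative is one monomial times a power. *)
Lemma bin_remainder x n t : `|t| < 1 -> exists2 z, `|z| <= `|t| &
  (bin_poly x n.+1).[t] * (1 + t) `^ (- x) - 1 =
  - (n.+1%:R * binc x n.+1 * z ^+ n * (1 + z) `^ (- x - 1) * t).
Proof.
move=> t1.
pose D t := (bin_poly x n.+1).[t] * (1 + t) `^ (- x).
pose dD z := - (n.+1%:R * binc x n.+1 * z ^+ n * (1 + z) `^ (- x - 1)).
have D0 : D 0 = 1.
  rewrite /D horner_bin_poly big_ord_recl big1 => [|i _]; last by rewrite expr0n /= mulr0.
  by rewrite !addr0 powR1 /binc /falling big_ord0 fact0 expr0 divr1 !mulr1.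
have dDP (z : R) : -1 < z -> is_derive z 1 D (dD z).
  move=> z1; have z0 : 0 < 1 + z by lra.
  have H1 : is_derive z (1 : R) ((@powR R ^~ (- x)) \o (fun z => 1 + z))
     (- x * (1 + z) `^ (- x - 1) * 1).
    apply: is_derive1_comp; first exact: is_derive1_powR.
    have := is_deriveD (is_derive_cst (1 : R) z (1 : R)) (is_derive_id z (1 : R)).
    by rewrite add0r.
  have H2 := is_deriveM (is_derive_poly (bin_poly x n.+1) z) H1.
  apply: (is_derive_eq H2); rewrite /= /dD -mulrN -[X in _ = _ X]/(_).
  have -> : (1 + z) `^ (- x) = (1 + z) * (1 + z) `^ (- x - 1).
    rewrite powRB; last by rewrite (gt_eqF z0) implybT.
    by rewrite powRr1 ?(ltW z0)//; field; rewrite gt_eqF.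
  rewrite -[RHS]/(_ * _); have := bin_poly_ode x n z.
  set Q := _ `^ _; set p1 := _.[z]; set p2 := _.[z] => E.
  rewrite /GRing.scale /=.
  transitivity (((1 + z) * p1 - x * p2) * Q); first by ring.
  by rewrite E; ring.
have cD a b : -1 < a -> {within `[a, b], continuous D}.
  move=> a1; apply: derivable_within_continuous => z; rewrite in_itv /= => /andP[az _].
  by have [] := dDP z (lt_le_trans a1 az).
suff [z zt E] : exists2 z, `|z| <= `|t| & D t - D 0 = dD z * t.
  by exists z => //; move: E; rewrite D0 /D => ->; rewrite /dD; ring.
move: t1; rewrite ltr_norml => /andP[t1 t2].
have [t0|t0] := leP 0 t.
  have [z|z|z zt E] := @MVT_segment R D dD 0 t t0.
  - by rewrite in_itv /= => /andP[z0 _]; apply: dDP; lra.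
  - exact: cD.
  - exists z; last by rewrite E subr0.
    by move: zt; rewrite in_itv /= => /andP[? ?]; rewrite !ger0_norm.
have [z|z|z zt E] := @MVT_segment R D dD t 0 (ltW t0).
- by rewrite in_itv /= => /andP[z0 _]; apply: dDP; lra.
- exact: cD.
- exists z; first by move: zt; rewrite in_itv /= => /andP[? ?];
  rewrite !ler0_norm ?lerN2// ltW.
  by rewrite -[LHS]opprB E; ring.
Qed.

Lemma binomial_series x t : 0 < x -> `|t| < 1 ->
  \sum_(s < n) binc x s * t ^+ s @[n --> \oo] --> (1 + t) `^ x.
Proof.
move=> x0 t1; have [C hC] := binc_bounded x x0.
have t1' : -1 < t by move: t1; rewrite ltr_norml => /andP[].
have p0 : 0 < (1 + t) `^ x by rewrite powR_gt0; lra.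
rewrite -cvg_shiftS /=.
(* [C] bounds the coefficient, the middle factor bounds the power at the intermediate point [z], and
   the last factor turns the relative remainder into an absolute one. What is left decays like the
   [n]-th power of the norm of [t]. *)
pose K := C * (1 - `|t|) `^ (- x - 1) * (1 + t) `^ x.
have C0 : 0 <= C by apply: le_trans (hC 0%N); rewrite mulr_ge0.
have H n : `|(\sum_(s < n.+1) binc x s * t ^+ s) - (1 + t) `^ x| <= K * `|t| ^+ n.
  rewrite -horner_bin_poly.
  have [z zt E] := bin_remainder x n t t1.
  have -> : (bin_poly x n.+1).[t] - (1 + t) `^ x =
     ((bin_poly x n.+1).[t] * (1 + t) `^ (- x) - 1) * (1 + t) `^ x.
    by rewrite powRN; field; rewrite gt_eqF.
  rewrite E normrM normrN (gtr0_norm p0) /K [X in _ <= X]mulrAC; apply: ler_wpM2r;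
    first exact: ltW.
  move: (hC n) => hb; set b := binc x n.+1 in hb *; clearbody b.
  rewrite !normrM normrX.
  rewrite (ger0_norm (powR_ge0 _ _)).
  have z1 : `|z| < 1 by apply: le_lt_trans t1.
  have pz : (1 + z) `^ (- x - 1) <= (1 - `|t|) `^ (- x - 1).
    have pt : 0 < 1 - `|t| by rewrite subr_gt0.
    have tz : 1 - `|t| <= 1 + z by move: zt; rewrite ler_norml => /andP[]; lra.
    have p1z := lt_le_trans pt tz.
    have -> : - x - 1 = - (x + 1) by ring.
    rewrite !powRN lef_pV2 ?posrE ?powR_gt0//.
    by apply: ge0_ler_powR; rewrite ?nnegrE//; lra.
  rewrite [X in _ <= X]mulrAC -[X in _ <= X]mulr1 (ger0_norm (ler0n _ _)).
  have zn : `|z| ^+ n <= `|t| ^+ n by exact: lerXn2r.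
  have c0 : 0 <= n.+1%:R * `|b| by rewrite mulr_ge0.
  have z0 : 0 <= `|z| ^+ n by exact: exprn_ge0.
  have h1 : n.+1%:R * `|b| * `|z| ^+ n <= C * `|t| ^+ n by exact: ler_pM.
  have q0 := powR_ge0 (1 + z) (- x - 1).
  have h2 := ler_pM (mulr_ge0 c0 z0) q0 h1 pz.
  exact: ler_pM (mulr_ge0 (mulr_ge0 c0 z0) q0) (normr_ge0 t) h2 (ltW t1).
apply/cvgrPdist_le => e e0.
have : K * `|t| ^+ n @[n --> \oo] --> K * 0.
  by apply: cvgM; [exact: cvg_cst|apply: cvg_expr; rewrite normr_id].
rewrite mulr0 => /cvgrPdist_le/(_ _ e0) H'.
near=> n; rewrite distrC (le_trans (H n))//.
have : `|0 - K * `|t| ^+ n| <= e by near: n.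
by rewrite sub0r normrN; apply: le_trans; exact: ler_norm.
Unshelve. all: by end_near. Qed.

End binomial_series.

(** * The Gamma function *)

Section gamma_function.
Context {R : realType}.
Implicit Types (x a t c : R).
Local Notation mu := (@lebesgue_measure R).

Definition gint x t : R := t `^ (x - 1) * expR (- t).

(** Extended-real valued, because finiteness is deduced from the functional equation [egammaS] and
    not conversely. *)
Definition egamma x : \bar R := (\int[mu]_(t in `]0%R, +oo[) (gint x t)%:E)%E.

Lemma gint_ge0 x t : 0 <= gint x t.
Proof. by rewrite mulr_ge0 ?powR_ge0 ?expR_ge0. Qed.

Lemma egamma_ge0 x : (0 <= egamma x)%E.
Proof. by apply: integral_ge0 => t _; rewrite lee_fin gint_ge0. Qed.

Lemma derivable_gint x t : 0 < t -> derivable (gint x) t 1.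
Proof.
move=> t0; apply: derivableM; first by apply: derivable_powR; rewrite in_itv /= t0.
have [//] : is_derive t 1 (fun t => expR (- t)) (expR (- t) * -1).
exact: (@is_derive1_comp R expR -%R).
Qed.

Lemma is_derive_gint x t : 0 < t ->
  is_derive t 1 (gint (x + 1)) (x * gint x t - gint (x + 1) t).
Proof.
move=> t0.
have E1 : is_derive t 1 (fun t => expR (- t)) (- expR (- t)).
  rewrite -[X in is_derive _ _ _ X]mulrN1.
  exact: (@is_derive1_comp R expR -%R).
have := is_deriveM (is_derive1_powR (x + 1 - 1) t0) E1.
move=> H; apply: (is_derive_eq H); rewrite /gint /GRing.scale /= addrK.
by ring.
Qed.

Lemma continuous_gint x (a b : R) : 0 < a -> {within `[a, b], continuous (gint x)}.
Proof.
move=> a0; apply: derivable_within_continuous => t; rewrite in_itv /= => /andP[at' _].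
exact: derivable_gint (lt_le_trans a0 at').
Qed.

Lemma measurable_gint x : measurable_fun setT (gint x).
Proof.
apply: measurable_funM; first exact: measurable_powR.
by apply: measurableT_comp => //; exact: measurable_expR.
Qed.

Lemma measurable_EFin_gint x (D : set R) :
  measurable_fun D (fun t => (gint x t)%:E).
Proof.
apply: measurable_funTS; apply: measurableT_comp; last exact: measurable_gint.
exact: EFin_measurable.
Qed.

Lemma integrable_gint x (a b : R) : 0 < a -> mu.-integrable `[a, b] (EFin \o gint x).
Proof.
move=> a0; apply: continuous_compact_integrable; first exact: segment_compact.
exact: continuous_gint.
Qed.

(** Integration by parts on a compact interval away from 0; sums on both sides avoid subtraction in
    the extended reals. *)
Lemma gint_parts x (a b : R) : 0 < a -> a < b ->
  (\int[mu]_(t in `[a, b]) (gint (x + 1) t)%:E + (gint (x + 1) b)%:E =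
   x%:E * \int[mu]_(t in `[a, b]) (gint x t)%:E + (gint (x + 1) a)%:E)%E.
Proof.
move=> a0 ab.
have [I1 I2] := (integrable_gint x a b a0, integrable_gint (x + 1) a b a0).
have dF t : 0 < t -> derivable (gint (x + 1)) t 1 by exact: derivable_gint.
have c0 (t : R) : 0 < t -> {for t, continuous (gint (x + 1))}.
  by move=> t0; apply/differentiable_continuous/derivable1_diffP/dF.
have b0 := lt_trans a0 ab.
have E := @continuous_FTC2 R (fun t => x * gint x t - gint (x + 1) t) (gint (x + 1)) a
  b ab.
have {}E : (\int[mu]_(t in `[a, b]) (x * gint x t - gint (x + 1) t)%:E =
    (gint (x + 1) b)%:E - (gint (x + 1) a)%:E)%E.
  apply: E.
  - apply: derivable_within_continuous => t; rewrite in_itv /= => /andP[at' _].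
    have t0 := lt_le_trans a0 at'.
    by apply: derivableB; [apply: derivableM => //|]; exact: derivable_gint.
  - split=> [t||].
    + by rewrite in_itv /= => /andP[at' _]; apply: dF; exact: lt_trans at'.
    + by apply: cvg_at_right_filter; exact: c0.
    + by apply: cvg_at_left_filter; exact: c0.
  - move=> t; rewrite in_itv /= => /andP[at' _]; rewrite derive1E.
    have H := is_derive_gint x t (lt_trans a0 at').
    exact: derive_val.
move: E; under eq_integral do rewrite EFinB EFinM.
rewrite integralB//=; last first.
  by apply: integrableZl => //; exact: I1.
rewrite integralZl//.
have J1 : (\int[mu]_(t in `[a, b]) (gint x t)%:E)%E \is a fin_num.
  by apply: integrable_fin_num => //; exact: I1.
have J2 : (\int[mu]_(t in `[a, b]) (gint (x + 1) t)%:E)%E \is a fin_num.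
  by apply: integrable_fin_num => //; exact: I2.
rewrite -(fineK J1) -(fineK J2) -EFinM -!EFinB -!EFinD => -[E].
by congr EFin; lra.
Qed.

(** With [k] at least [x - 1], the bound of [expR t] below by [t ^ (k + 1) / (k + 1)!] leaves at
    most [(k + 1)! / t]. *)
Lemma gint_cvgy x : gint x n.+2%:R @[n --> \oo] --> 0.
Proof.
have [k xk] : exists k : nat, x - 1 <= k%:R.
  by exists (Num.truncn (x - 1)).+1; rewrite ltW// truncnS_gt.
have H n : 0 <= gint x n.+2%:R <= (k.+1)`!%:R * harmonic n.
  rewrite gint_ge0 /= /gint /harmonic /=.
  set t : R := n.+2%:R; have t0 : 0 < t by rewrite ltr0n.
  have t1 : 1 <= t by rewrite ler1n.
  have h1 : t `^ (x - 1) <= t ^+ k by rewrite -powR_mulrn ?ler_powR// ltW.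
  have h2 : expR (- t) <= (k.+1)`!%:R / t ^+ k.+1.
    rewrite expRN -[X in _ <= X]invrK lef_pV2 ?posrE ?expR_gt0 ?invr_gt0 ?divr_gt0
      ?exprn_gt0 ?ltr0n ?fact_gt0//.
    rewrite invf_div (le_trans _ (expR_ge1Dxn k (ltW t0)))// lerDr ler01//.
  apply: (le_trans (ler_pM _ _ h1 h2)); rewrite ?powR_ge0 ?expR_ge0//.
  rewrite mulrCA ler_pM2l ?ltr0n ?fact_gt0// exprS invfM mulrCA divff ?gt_eqF
    ?exprn_gt0// mulr1.
  by rewrite lef_pV2 ?posrE ?ltr0n// ler_nat.
apply: (@squeeze_cvgr _ _ _ _ (fun=> 0) (fun n => (k.+1)`!%:R * harmonic n)).
- by apply: nearW.
- exact: cvg_cst.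
- by rewrite -[X in _ --> X](mulr0 (k.+1)`!%:R); apply: cvgM;
  [exact: cvg_cst|exact: cvg_harmonic].
Qed.

Lemma gint_cvg0 x : 0 < x -> gint (x + 1) n.+2%:R^-1 @[n --> \oo] --> 0.
Proof.
move=> x0.
have H n : 0 <= gint (x + 1) n.+2%:R^-1 <= n.+2%:R^-1 `^ x.
  rewrite gint_ge0 /= /gint addrK ler_piMr ?powR_ge0// -[leRHS]expR0 ler_expR oppr_le0
    invr_ge0.
apply: (@squeeze_cvgr _ _ _ _ (fun=> 0) (fun n => n.+2%:R^-1 `^ x)).
- by apply: nearW.
- exact: cvg_cst.
- have /cvg_at_rightP H1 := powR_cvg0 x0.
  apply: (H1 (fun n => n.+2%:R^-1)); split=> [n|]; first by rewrite invr_gt0.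
  have := @cvg_harmonic R; rewrite -cvg_shiftS; exact.
Qed.

Lemma egammaS x : 0 < x -> egamma (x + 1) = (x%:E * egamma x)%E.
Proof.
move=> x0.
(* These intervals exhaust the half-line, so monotone convergence applies. The offset 2 keeps their
   endpoints distinct, as [gint_parts] requires. *)
pose F n : set R := `[n.+2%:R^-1, n.+2%:R]%classic.
have bF : \bigcup_n F n = `]0, +oo[%classic.
  apply/seteqP; split=> [t [n _]|t] /=; rewrite !in_itv /= ?andbT.
    by rewrite /F /= in_itv /= => /andP[h _]; apply: lt_le_trans h; rewrite invr_gt0.
  move=> t0; exists (maxn (Num.truncn t) (Num.truncn t^-1)) => //.
  rewrite /F /= in_itv /=; apply/andP; split; last first.
    rewrite ltW// (lt_le_trans (truncnS_gt _))// ler_nat.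
    by rewrite ltnW// !ltnS leq_maxl.
  rewrite -[leRHS]invrK lef_pV2 ?posrE ?invr_gt0// ltW// (lt_le_trans (truncnS_gt _))//
    ler_nat.
  by rewrite ltnW// !ltnS leq_maxr.
have ndF : {homo F : n m / (n <= m)%N >-> (n <= m)%O}.
  move=> n m nm; apply/subsetPset => t; rewrite /F /= !in_itv /= => /andP[h1 h2];
    apply/andP; split.
    by apply: le_trans h1; rewrite lef_pV2 ?posrE// ler_nat !ltnS.
  by apply: le_trans h2 _; rewrite ler_nat !ltnS.
have cvgI y : (\int[mu]_(t in F n) (gint y t)%:E @[n --> \oo] --> egamma y)%E.
  rewrite /egamma -bF; apply: ge0_nondecreasing_set_cvg_integral => //.
  - by move=> i; rewrite /F; exact: measurable_itv.
  - by move=> i; exact: measurable_EFin_gint.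
  - by move=> i t _; rewrite lee_fin gint_ge0.
have L : ((\int[mu]_(t in F n) (gint (x + 1) t)%:E + (gint (x + 1) n.+2%:R)%:E)
   @[n --> \oo] --> egamma (x + 1) + 0%:E)%E.
  apply: cvgeD; [by rewrite fin_num_adde_defl|exact: cvgI|].
  by apply/cvg_EFin; [exact: nearW|exact: gint_cvgy].
have L' : (x%:E * (\int[mu]_(t in F n) (gint x t)%:E) + (gint (x + 1) n.+2%:R^-1)%:E
   @[n --> \oo] --> x%:E * egamma x + 0%:E)%E.
  apply: cvgeD; [by rewrite fin_num_adde_defl|by apply: cvgeZl => //; exact: cvgI|].
  by apply/cvg_EFin; [exact: nearW|exact: gint_cvg0].
rewrite !adde0 in L L'; apply: (cvg_unique _ L); first exact: ereal_hausdorff.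
apply: cvg_trans L'; apply: near_eq_cvg; apply: nearW => n.
rewrite gint_parts// ?invr_gt0// (@lt_trans _ _ 1)// ?ltr1n// invf_lt1// ltr1n//.
Qed.

Lemma egamma1 : egamma 1 = 1%E.
Proof.
rewrite /egamma.
transitivity (\int[mu]_(t in `]0%R, +oo[) (expR (- t))%:E)%E.
  by apply: eq_integral => t _; rewrite /gint subrr powRr0 mul1r.
have cN (t : R) : {for t, continuous (fun t => expR (- t) : R)}.
  apply: (@continuous_comp R R R -%R expR);
    [exact: opp_continuous|exact: continuous_expR].
have dN (t : R) : is_derive t 1 (fun t => - expR (- t) : R) (expR (- t)).
  have H : is_derive t 1 (fun t => expR (- t)) (expR (- t) * -1).
    exact: (@is_derive1_comp R expR -%R).
  by have := is_deriveN H; rewrite mulrN1 opprK.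
rewrite integral_itv_obnd_cbnd; last first.
  apply/measurable_EFinP; apply: measurable_funTS; apply: continuous_measurable_fun => t;
    exact: cN.
rewrite (@ge0_continuous_FTC2y R _ (fun t => - expR (- t)) 0 0).
- by rewrite oppr0 expR0 -EFinB sub0r opprK.
- by move=> t _; exact: expR_ge0.
- by apply: continuous_subspaceT => t; exact: cN.
- by rewrite -oppr0; apply: cvgN; exact: cvgr_expR.
- by move=> t _; have [] := dN t.
- by apply: cvg_at_right_filter; apply: cvgN; exact: cN.
- by move=> t _; rewrite derive1E; have H := dN t; exact: derive_val.
Qed.

(** Positive integers follow from [egamma1] by the functional equation. At [x + 1] the bound
    [t ^ x <= 1 + t ^ k] dominates by two integer cases, and [egammaS] descends to [x], avoiding the
    singularity at 0. *)
Lemma egamma_fin x : 0 < x -> egamma x \is a fin_num.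
Proof.
move=> x0; suff: (egamma x < +oo)%E by rewrite ge0_fin_numE ?egamma_ge0.
have finN n : egamma n.+1%:R \is a fin_num.
  elim: n => [|n IH]; first by rewrite egamma1.
  by rewrite -natr1 egammaS// fin_numM.
have fin1 : (egamma (x + 1) < +oo)%E.
  have [k xk] : exists k : nat, x <= k%:R.
    by exists (Num.truncn x).+1; rewrite ltW// truncnS_gt.
  apply: (@le_lt_trans _ _ (egamma 1 + egamma k.+1%:R)%E); last first.
    have f1 : (egamma 1 < +oo)%E by rewrite egamma1 ltry.
    have fk : (egamma k.+1%:R < +oo)%E by rewrite -ge0_fin_numE ?egamma_ge0.
    exact: lte_add_pinfty.
  rewrite /egamma -ge0_integralD//; first last.
  - by exact: measurable_EFin_gint.
  - by move=> t _; rewrite lee_fin gint_ge0.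
  - by exact: measurable_EFin_gint.
  - by move=> t _; rewrite lee_fin gint_ge0.
  apply: ge0_le_integral => //.
  - by move=> t _; rewrite lee_fin gint_ge0.
  - by exact: measurable_EFin_gint.
  - by apply: emeasurable_funD; exact: measurable_EFin_gint.
  move=> t /=; rewrite in_itv /= andbT => t0; rewrite -EFinD lee_fin /gint -mulrDl.
  apply: ler_wpM2r; first exact: expR_ge0.
  rewrite addrK subrr powRr0 -natr1 addrK.
  have [t1|/ltW t1] := leP t 1.
    rewrite (@le_trans _ _ 1) ?lerDl ?powR_ge0//.
    by rewrite -(powRr0 t) ger_powR ?t0 // ltW.
  by rewrite (@le_trans _ _ (t `^ k%:R)) ?ler_powR// lerDr.
move: fin1; rewrite egammaS//; move: (egamma_ge0 x).
by case: (egamma x) => [r _ _| _ |//]; rewrite ?ltry// gt0_muley.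
Qed.

Lemma GammaE x : 0 < x -> (Gamma x)%:E = egamma x.
Proof. by move=> x0; rewrite -(fineK (egamma_fin x x0)). Qed.

Lemma GammaS x : 0 < x -> Gamma (x + 1) = x * Gamma x.
Proof.
move=> x0; apply: EFin_inj; rewrite EFinM !GammaE ?egammaS//.
by rewrite addr_gt0.
Qed.

Lemma Gamma_gt0 x : 0 < x -> 0 < Gamma x.
Proof.
move=> x0; rewrite -lte_fin GammaE//.
apply: (@lt_le_trans _ _ (\int[mu]_(t in `[1%R, 2%R]) (2^-1 * expR (- 2))%:E)%E).
  rewrite integral_cst//= lebesgue_measure_itv /= lte_fin ltr1n /= -EFinB -EFinM lte_fin.
  by rewrite !mulr_gt0 ?expR_gt0 ?invr_gt0//; lra.
apply: (@le_trans _ _ (\int[mu]_(t in `[1%R, 2%R]) (gint x t)%:E)%E).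
  apply: ge0_le_integral => //.
  - by exact: measurable_EFin_gint.
  move=> t /=; rewrite in_itv /= => /andP[t1 t2]; rewrite lee_fin /gint.
  apply: ler_pM; rewrite ?expR_ge0 ?invr_ge0 ?ler_expR ?lerN2//.
  apply: (@le_trans _ _ (t `^ (- 1))).
    by rewrite powR_inv1 ?lef_pV2 ?posrE//; lra.
  by apply: ler_powR => //; lra.
apply: ge0_subset_integral => //.
- by exact: measurable_EFin_gint.
- by move=> t _; rewrite lee_fin gint_ge0.
- by move=> t /=; rewrite !in_itv /= andbT => /andP[t1 _]; exact: lt_le_trans t1.
Qed.

(** Apply [ln y <= y - 1] at [u / s] and at [1 / s] with weights [a] and [1 - a]: the right sides
    cancel by the choice of [s]. *)
Lemma powR_bernoulli (u a : R) : 0 < u -> 0 <= a <= 1 -> u `^ a <= 1 + a * (u - 1).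
Proof.
move=> u0 /andP[a0 a1]; set s := 1 + a * (u - 1).
have s0 : 0 < s.
  have -> : s = (1 - a) + a * u by rewrite /s; ring.
  have [->|/eqP an] := a =P 0; first by rewrite subr0 mul0r addr0.
  by rewrite ltr_wpDl ?subr_ge0// mulr_gt0// lt_neqAle eq_sym an.
have lnle (y : R) : 0 < y -> ln y <= y - 1.
  move=> y0; have -> : y = 1 + (y - 1) by ring.
  by rewrite (le_trans (le_ln1Dx _)); lra.
have h1 := lnle (u / s) (divr_gt0 u0 s0).
have h2 : ln s^-1 <= s^-1 - 1 by apply: lnle; rewrite invr_gt0.
rewrite ln_div ?posrE// in h1; rewrite lnV ?posrE// in h2.
rewrite -ler_ln ?posrE ?powR_gt0// ln_powR.
have h3 := ler_wpM2l a0 h1.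
have a1' : 0 <= 1 - a by rewrite subr_ge0.
have h4 := ler_wpM2l a1' h2.
have E : a * (u / s - 1) + (1 - a) * (s^-1 - 1) = 0.
  rewrite /s; field; move: s0; rewrite /s => s0; rewrite gt_eqF//.
nra.
Qed.

(* Wendel's inequality: [powR_bernoulli] at [t / x], integrated against the
   density of [Gamma x]. *)
Lemma Gamma_wendel x a : 0 < x -> 0 <= a <= 1 -> Gamma (x + a) <= x `^ a * Gamma x.
Proof.
move=> x0 a01; have /andP[a0 a1] := a01.
have xa0 : 0 < x + a by rewrite ltr_wpDr.
(* By [GammaS], the right side becomes the integral of [x ^ a * (1 + a * (t / x - 1))] against the
   density, ready for a pointwise comparison. *)
have -> : x `^ a * Gamma x = x `^ a * ((1 - a) * Gamma x + a / x * Gamma (x + 1)).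
  by rewrite GammaS//; congr (_ * _); field; rewrite gt_eqF.
have x10 : 0 < x + 1 by rewrite addr_gt0.
have c1 : 0 <= x `^ a * (1 - a) by rewrite mulr_ge0 ?powR_ge0 ?subr_ge0.
have c2 : 0 <= x `^ a * a / x by rewrite -mulrA mulr_ge0 ?powR_ge0 ?divr_ge0 ?(ltW x0).
rewrite -lee_fin mulrDr !mulrA EFinD !(EFinM _ (Gamma _)) !GammaE// /egamma.
pose D : set R := `]0, +oo[%classic.
have mg y : measurable_fun D (fun t => (gint y t)%:E) by exact: measurable_EFin_gint.
rewrite -!ge0_integralZl//=; first last.
all: try by move=> t _; rewrite lee_fin gint_ge0.
all: try exact: mg.
have mg' y c : measurable_fun D (fun t => (c%:E * (gint y t)%:E)%E).
  by apply: measurable_funeM; exact: mg.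
rewrite -ge0_integralD//=; first last.
all: try by move=> t _; rewrite mule_ge0// lee_fin// gint_ge0.
all: try exact: mg'.
apply: ge0_le_integral => //.
- by move=> t _; rewrite lee_fin gint_ge0.
- exact: mg.
- by apply: emeasurable_funD; exact: mg'.
move=> t /=; rewrite in_itv /= andbT => t0; rewrite -!EFinM -EFinD lee_fin /gint.
have -> : t `^ (x + a - 1) = t `^ (x - 1) * t `^ a.
  by rewrite -powRD ?(gt_eqF t0) ?implybT//; congr (_ `^ _); ring.
have -> : t `^ (x + 1 - 1) = t `^ (x - 1) * t.
  by rewrite -{3}(powRr1 (ltW t0)) -powRD ?(gt_eqF t0) ?implybT//; congr (_ `^ _); ring.
have := powR_bernoulli (t / x) a (divr_gt0 t0 x0) a01.
have xa : 0 < x `^ a by rewrite powR_gt0.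
rewrite powRM ?(ltW t0) ?invr_ge0 ?(ltW x0)// -powR_inv1 ?(ltW x0)// -powRrM mulN1r powRN.
rewrite ler_pdivrMr// powR_inv1 ?(ltW x0)// => H.
have e0 := expR_ge0 (- t); have p0 := powR_ge0 t (x - 1).
have := ler_wpM2l (mulr_ge0 p0 e0) H.
set A := t `^ _; set B := expR _; set C := t `^ _; set Q := x `^ _ => K.
rewrite mulrAC (le_trans K)// le_eqVlt; apply/orP; left; apply/eqP; field.
by rewrite gt_eqF.
Qed.

Lemma Gamma_prod c m : 0 < c -> Gamma (c + m%:R) = Gamma c * \prod_(n < m) (n%:R + c).
Proof.
move=> c0; elim: m => [|m IH]; first by rewrite big_ord0 addr0 mulr1.
by rewrite big_ord_recr /= -natr1 addrA GammaS ?IH ?ltr_wpDr//; ring.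
Qed.

(** By [Gamma_prod] the product is the limit times a factor tending to 1. With [y = c + m],
    [Gamma_wendel] at [y] with increment [a] bounds this factor below by [1 - c / y], and at [y + a]
    with increment [1 - a] above by [1 + a / y]. *)
Lemma prod_cvg_Gamma c a : 0 < c -> 0 <= a <= 1 ->
  (\prod_(n < m) ((n%:R + c) / (n%:R + c + a))) * m%:R `^ a @[m --> \oo] -->
  Gamma (c + a) / Gamma c.
Proof.
move=> c0 a01; have /andP[a0 a1] := a01.
have ca0 : 0 < c + a by rewrite ltr_wpDr.
have cm m : 0 < c + m%:R by rewrite ltr_wpDr.
have E m : (\prod_(n < m) ((n%:R + c) / (n%:R + c + a))) * m%:R `^ a =
   Gamma (c + a) / Gamma c * (m%:R `^ a * Gamma (c + m%:R) / Gamma (c + m%:R + a)).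
  rewrite prodf_div [c + _ + a]addrAC !Gamma_prod//.
  have -> : \prod_(i < m) (i%:R + c + a) = \prod_(i < m) (i%:R + (c + a)).
    by apply: eq_bigr => i _; rewrite addrA.
  have := Gamma_gt0 _ c0; have := Gamma_gt0 _ ca0.
  have : 0 < \prod_(i < m) (i%:R + (c + a)) by apply: prodr_gt0 => i _; rewrite ltr_wpDl.
  by move=> h1 h2 h3; field; rewrite !gt_eqF.
suff K : m%:R `^ a * Gamma (c + m%:R) / Gamma (c + m%:R + a) @[m --> \oo] --> (1 : R).
  have K' := cvgM (cvg_cst (Gamma (c + a) / Gamma c : R)) K; rewrite mulr1 in K'.
  by rewrite (funext E); exact: K'.
have cv0 (b : R) : b / (c + m%:R) @[m --> \oo] --> 0.
  rewrite -[X in _ --> X](mulr0 b); apply: cvgM; first exact: cvg_cst.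
  apply/gtr0_cvgV0; first by apply: nearW => m; exact: cm.
  exact: (cvg_comp (fun m : nat => m%:R) (fun r => c + r) cvgr_idn (cvg_addrl c)).
apply: (@squeeze_cvgr _ _ _ _ (fun m => 1 - c / (c + m%:R)) (fun m => 1 + a / (c +
  m%:R))); last 2 first.
- by rewrite -[X in _ --> X]subr0; apply: cvgB; [exact: cvg_cst|exact: cv0].
- by rewrite -[X in _ --> X]addr0; apply: cvgD; [exact: cvg_cst|exact: cv0].
apply: nearW => m; set y := c + m%:R; have y0 : 0 < y := cm m.
have m0 := ler0n R m.
have ya0 : 0 < y + a by rewrite ltr_wpDr.
have gy := Gamma_gt0 _ y0; have gya := Gamma_gt0 _ ya0.
have my : m%:R = y - c by rewrite /y; ring.
apply/andP; split.
  rewrite ler_pdivlMr//; apply: (le_trans (ler_wpM2l _ (Gamma_wendel y a y0 a01))).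
    by rewrite subr_ge0 ler_pdivrMr// mul1r lerDl.
  rewrite mulrA ler_pM2r//.
  have -> : 1 - c / y = m%:R / y by rewrite my; field; rewrite gt_eqF.
  have [->|/eqP m1] := m%:R =P 0 :> R; first by rewrite !mul0r powR_ge0.
  have my0 : 0 < m%:R / y by rewrite divr_gt0// lt_neqAle eq_sym m1.
  have -> : m%:R `^ a = (m%:R / y) `^ a * y `^ a.
    by rewrite -powRM ?divfK ?gt_eqF ?(ltW my0) ?(ltW y0).
  rewrite ler_pM2r ?powR_gt0//; apply: ger1_powR => //.
  by rewrite my0 ler_pdivrMr// mul1r my lerBlDr lerDl ltW.
rewrite ler_pdivrMr//.
have W : y * Gamma y <= (y + a) `^ (1 - a) * Gamma (y + a).
  rewrite -GammaS//; have -> : y + 1 = y + a + (1 - a) by ring.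
  by apply: Gamma_wendel; rewrite // subr_ge0 lerBlDr lerDl a0 a1.
have ma : m%:R `^ a <= (y + a) `^ a.
  by apply: ge0_ler_powR; rewrite ?nnegrE// ?(ltW ya0)// my; lra.
rewrite -(ler_pM2l y0) mulrCA.
apply: (le_trans (ler_pM (powR_ge0 _ _) (mulr_ge0 (ltW y0) (ltW gy)) ma W)).
rewrite mulrA -powRD; last by rewrite (gt_eqF ya0) implybT.
have -> : a + (1 - a) = 1 by ring.
rewrite powRr1 ?(ltW ya0)// mulrA le_eqVlt; apply/orP; left; apply/eqP.
by congr (_ * _); field; rewrite gt_eqF.
Qed.

End gamma_function.

(** * Asymptotics of the normalisation *)

Section normalisation.
Context {R : realType} (p : nat) (sigma ell w0 b0 : R).
Context (hp : (0 < p)%N) (hsigma : 0 < sigma) (hell : 0 < ell)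
  (hw0 : 0 < w0) (hb0 : 0 <= b0).

Local Notation T := (Ttot p sigma ell w0 b0).
Local Notation g := (gN p sigma ell w0 b0).
Local Notation ps := (psi p sigma ell).
Local Notation Lam := (Lambda p sigma ell).

Lemma Ttot_gt0 N : 0 < T N.
Proof.
rewrite /Ttot ltr_wpDr// ltr_wpDl// addr_ge0 ?mulr_ge0 ?(ltW hsigma)//.
by rewrite addr_ge0 ?mulr_ge0// ltW.
Qed.

Lemma psi_gt0 : 0 < ps.
Proof. by rewrite /psi ltr_wpDl// divr_gt0. Qed.

Lemma psi_gt1 : 1 < ps.
Proof. by rewrite /psi ltr_pwDr ?divr_gt0// ler1n. Qed.

Lemma Lambda_gt0 : 0 < Lam.
Proof. by rewrite /Lambda divr_gt0 ?psi_gt0// ltr0n. Qed.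

Lemma Lambda_le1 : Lam <= 1.
Proof. by rewrite /Lambda ler_pdivrMr ?psi_gt0// mul1r /psi lerDl divr_ge0// ltW. Qed.

Lemma gNS N : g N.+1 = g N * (T N / (T N + sigma)).
Proof. exact: big_ord_recr. Qed.

Lemma gN_gt0 N : 0 < g N.
Proof.
apply: prodr_gt0 => i _; have T0 := Ttot_gt0 i.
by rewrite divr_gt0// addr_gt0.
Qed.

Lemma gN_decr N M : (N <= M)%N -> g M <= g N.
Proof.
move=> /subnKC <-; elim: (M - N)%N => [|k IH]; first by rewrite addn0.
rewrite addnS gNS (le_trans _ IH)// ler_piMr ?(ltW (gN_gt0 _))//.
have T0 := Ttot_gt0 (N + k).
by rewrite ler_pdivrMr ?mul1r ?lerDl ?ltW// addr_gt0.
Qed.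

(** At time [m * p + r] the total is [sigma * ps] times [m + c r], so each residue class contributes
    a product of the shape in [prod_cvg_Gamma]. *)
Let c r : R := r%:R / ps + (w0 + b0) / (sigma * ps).

Lemma Ttot_residue m r : (r < p)%N -> T (m * p + r) = sigma * ps * (m%:R + c r).
Proof.
move=> rp; rewrite /Ttot divnMDl// divn_small// addn0 modnMDl modn_small//.
rewrite /c; have := psi_gt0; rewrite /psi => h.
field; rewrite !gt_eqF//=.
have -> : p%:R * sigma + ell = sigma * (p%:R + ell / sigma) by field; rewrite gt_eqF.
by rewrite mulr_gt0.
Qed.

Lemma residue_gt0 r : 0 < c r.
Proof.
rewrite /c ltr_wpDl//; first by rewrite divr_ge0// ltW// psi_gt0.
by rewrite divr_gt0 ?ltr_wpDr//; rewrite mulr_gt0// psi_gt0.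
Qed.

Lemma gN_mulp m :
  g (m * p) = \prod_(r < p) \prod_(n < m) ((n%:R + c r) / (n%:R + c r + 1 / ps)).
Proof.
elim: m => [|m IH].
  by rewrite mul0n /gN big_ord0 big1// => r _; rewrite big_ord0.
under eq_bigr do rewrite big_ord_recr.
rewrite big_split /= -IH mulSn addnC /gN big_split_ord /=; congr (_ * _).
apply: eq_bigr => r _; rewrite Ttot_residue//.
have q0 : sigma * ps != 0 by rewrite gt_eqF// mulr_gt0// psi_gt0.
have -> : sigma * ps * (m%:R + c r) + sigma = sigma * ps * (m%:R + c r + 1 / ps).
  by field; rewrite gt_eqF// psi_gt0.
by rewrite -mulf_div divff// mul1r.
Qed.

Lemma cvg_prod_ord (n : nat) (F : nat -> nat -> R) (l : nat -> R) :
  (forall r, (r < n)%N -> F r m @[m --> \oo] --> l r) ->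
  \prod_(r < n) F r m @[m --> \oo] --> \prod_(r < n) l r.
Proof.
elim: n => [|n IH] H.
  by under eq_fun do rewrite big_ord0; rewrite big_ord0; exact: cvg_cst.
under eq_fun do rewrite big_ord_recr; rewrite big_ord_recr.
by apply: cvgM; [apply: IH => r rn; apply: H; exact: leqW|exact: H].
Qed.

Lemma gN_mulp_cvg :
  g (m * p) * (m * p)%N%:R `^ Lam @[m --> \oo] --> kappa p sigma ell w0 b0.
Proof.
have E m : g (m * p) * (m * p)%N%:R `^ Lam = p%:R `^ Lam *
  \prod_(r < p) ((\prod_(n < m) ((n%:R + c r) / (n%:R + c r + 1 / ps))) * m%:R `^ (1 /
    ps)).
  rewrite gN_mulp big_split /= prodr_const card_ord natrM powRM//.
  rewrite -powR_mulrn ?powR_ge0// -powRrM.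
  have -> : 1 / ps * p%:R = Lam by rewrite /Lambda; ring.
  by ring.
rewrite (funext E) /kappa; apply: cvgM; first exact: cvg_cst.
apply: (cvg_prod_ord p
  (fun r m => (\prod_(n < m) ((n%:R + c r) / (n%:R + c r + 1 / ps))) * m%:R `^ (1 / ps))
  (fun r => Gamma (c r + 1 / ps) / Gamma (c r))) => r _.
apply: prod_cvg_Gamma; first exact: residue_gt0.
by rewrite divr_ge0 ?(ltW psi_gt0)// ler_pdivrMr ?psi_gt0// mul1r ltW ?psi_gt1.
Qed.

Lemma kappa_gt0 : 0 < kappa p sigma ell w0 b0.
Proof.
rewrite /kappa mulr_gt0 ?powR_gt0 ?ltr0n//; apply: prodr_gt0 => r _.
have cr := residue_gt0 r.
by rewrite -/(c r) divr_gt0// Gamma_gt0// addr_gt0// divr_gt0// psi_gt0.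
Qed.

Lemma cvg_divn : (N %/ p)%N @[N --> \oo] --> \oo.
Proof.
apply/cvgnyPge => a; near=> N; rewrite leq_divRL//.
by near: N; exact: nbhs_infty_ge.
Unshelve. all: by end_near. Qed.

Lemma gN_cvg : g N * N%:R `^ Lam @[N --> \oo] --> kappa p sigma ell w0 b0.
Proof.
pose h m := g (m * p) * (m * p)%N%:R `^ Lam.
(* [rho m] compares the powers at consecutive multiples of [p]. With [m = N %/ p], monotonicity of
   [g] places the sequence between [h m.+1 * rho m] and [h m / rho m]. *)
pose rho (m : nat) : R := (m%:R / m.+1%:R) `^ Lam.
have rho1 : rho m @[m --> \oo] --> (1 : R).
  (* Since [Lam] is in []0, 1]], raising [m / (m + 1)] to it gives a value between the base and
     1. *)
  apply: (@squeeze_cvgr _ _ _ _ (fun m => 1 - harmonic m) (fun=> 1)).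
  - apply: nearW => m; rewrite /harmonic /=.
    have -> : 1 - m.+1%:R^-1 = m%:R / m.+1%:R :> R.
      by rewrite -natr1; field; rewrite natr1 pnatr_eq0.
    have r01 : 0 <= (m%:R / m.+1%:R : R) <= 1.
      by rewrite divr_ge0//= ler_pdivrMr// mul1r ler_nat.
    have /andP[r0 r1] := r01; apply/andP; split.
      have [->|/eqP m0] := m%:R / m.+1%:R =P 0 :> R; first exact: powR_ge0.
      by apply: ger1_powR => //; [rewrite lt_neqAle eq_sym m0 r0 r1|exact: Lambda_le1].
    have : (m%:R / m.+1%:R) `^ Lam <= 1 `^ Lam.
      by apply: ge0_ler_powR; rewrite ?nnegrE// ltW// Lambda_gt0.
    by rewrite powR1.
  - by rewrite -[X in _ --> X]subr0; apply: cvgB; [exact: cvg_cst|exact: cvg_harmonic].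
  - exact: cvg_cst.
have cl : h m.+1 * rho m @[m --> \oo] --> kappa p sigma ell w0 b0.
  rewrite -[X in _ --> X]mulr1; apply: cvgM => //.
  have := gN_mulp_cvg; rewrite -cvg_shiftS; exact.
have cu : h m / rho m @[m --> \oo] --> kappa p sigma ell w0 b0.
  rewrite -[X in _ --> X]mulr1 -[1 in X in _ --> X]invr1; apply: cvgM;
    first exact: gN_mulp_cvg.
  by apply: cvgV => //; exact: oner_neq0.
have cl' := cvg_comp _ _ cvg_divn cl; have cu' := cvg_comp _ _ cvg_divn cu.
apply: squeeze_cvgr cl' cu'.
near=> N; rewrite /=; set m := (N %/ p)%N.
have m0 : (0 < m)%N by rewrite divn_gt0//; near: N; exact: nbhs_infty_ge.
have mN : (m * p <= N)%N by exact: leq_trunc_div.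
have Nm : (N <= m.+1 * p)%N by rewrite ltnW// ltn_ceil.
have rE : rho m = (m * p)%N%:R `^ Lam / (m.+1 * p)%N%:R `^ Lam.
  rewrite /rho; have p0 : p%:R != 0 :> R by rewrite pnatr_eq0 -lt0n.
  have -> : m%:R / m.+1%:R = (m * p)%N%:R / (m.+1 * p)%N%:R :> R.
    by rewrite !natrM -mulf_div divff// mulr1.
  by rewrite powRM ?invr_ge0// -powR_inv1// -powRrM mulN1r powRN.
have le_pow a b : (a <= b)%N -> a%:R `^ Lam <= b%:R `^ Lam :> R.
  by move=> ab; apply: ge0_ler_powR; rewrite ?nnegrE ?ler_nat// ltW// Lambda_gt0.
have pm : 0 < (m * p)%N%:R `^ Lam :> R by rewrite powR_gt0// ltr0n muln_gt0 m0.
have pm1 : 0 < (m.+1 * p)%N%:R `^ Lam :> R by rewrite powR_gt0// ltr0n muln_gt0.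
apply/andP; split.
  have -> : h m.+1 * rho m = g (m.+1 * p) * (m * p)%N%:R `^ Lam.
    by rewrite /h rE; field; rewrite gt_eqF.
  by apply: ler_pM; rewrite ?powR_ge0 ?(ltW (gN_gt0 _)) ?gN_decr ?le_pow.
have -> : h m / rho m = g (m * p) * (m.+1 * p)%N%:R `^ Lam.
  by rewrite /h rE; field; rewrite !gt_eqF.
by apply: ler_pM; rewrite ?powR_ge0 ?(ltW (gN_gt0 _)) ?gN_decr ?le_pow.
Unshelve. all: by end_near. Qed.

End normalisation.

(** * The urn *)

Section urn.
Context {R : realType} (p : nat) (sigma ell w0 b0 : R).
Context (hp : (0 < p)%N) (hsigma : 0 < sigma) (hell : 0 < ell)
  (hw0 : 0 < w0) (hb0 : 0 <= b0).

Local Notation T := (Ttot p sigma ell w0 b0).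
Local Notation g := (gN p sigma ell w0 b0).
Local Notation W := (Wpath sigma w0).
Local Notation B := (Bpath p sigma ell b0).

Definition pwhite (N : nat) (h : nat -> bool) : R := W h N / (W h N + B h N).

Lemma Wpath_depends N : depends N (W ^~ N).
Proof.
elim: N => [//|N IH] h h' hh' /=.
by rewrite (IH h h') ?hh'// => i iN; apply: hh'; exact: ltnW.
Qed.

Lemma Wpath_gt0 h N : 0 < W h N.
Proof.
by elim: N => [//|N IH] /=; case: (h N); rewrite ?addr0 ?addr_gt0.
Qed.

Lemma Bpath_ge0 h N : 0 <= B h N.
Proof.
have s0 := ltW hsigma; have l0 := ltW hell.
by elim: N => [//|N IH] /=; case: (h N); case: ifP; rewrite ?addr0 ?addr_ge0.
Qed.

Lemma TtotS N : T N.+1 = T N + sigma + (if (p %| N.+1)%N then ell else 0).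
Proof.
rewrite /Ttot divnS// modnS; case: ifP => [pN|_] /=; last first.
  by rewrite add0n -natr1; ring.
(* Just before a multiple of [p] the residue is [p - 1]; one more [sigma] completes a period and the
   residue resets. *)
have : (N %% p).+1 = p.
  have := divn_eq N.+1 p; rewrite divnS// modnS pN /= addn0 add1n mulSn.
  by have := divn_eq N p; lia.
move=> /(congr1 (fun n => n%:R : R)); rewrite -natr1 => <-.
by rewrite add1n -natr1; ring.
Qed.

Lemma total_path h N : W h N + B h N = T N.
Proof.
elim: N => [|N IH]; first by rewrite /Ttot div0n mod0n /=; ring.
by rewrite TtotS -IH /=; case: (h N); case: ifP => _; ring.
Qed.

Lemma pwhiteE N h : pwhite N h = W h N / T N.
Proof. by rewrite /pwhite total_path. Qed.

Lemma pwhite_ge0_le1 N h : 0 <= pwhite N h <= 1.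
Proof.
have w := Wpath_gt0 h N; have b := Bpath_ge0 h N.
rewrite /pwhite divr_ge0 ?addr_ge0 ?(ltW w)//=.
by rewrite ler_pdivrMr ?mul1r ?lerDl// ltr_wpDr.
Qed.

(** Both sides equal [rising x s.+1], split at its first or at its last factor. *)
Lemma rising_shift (x : R) s : x * rising (x + 1) s = rising x s * (x + s%:R).
Proof.
elim: s => [|s IH]; first by rewrite /rising !big_ord0; ring.
by rewrite !risingS mulrA IH -natr1; ring.
Qed.

(** With [x = W / sigma], white has probability [x * sigma / T]; that factor [x] lets [rising_shift]
    bring the shifted factorial back to [rising x s]. *)
Lemma step_rising N s h :
  step pwhite N (fun h => rising (W h N.+1 / sigma) s) h =
  ((T N + s%:R * sigma) / T N) * rising (W h N / sigma) s.
Proof.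
have T0 := Ttot_gt0 p sigma ell w0 b0 hsigma hell hw0 hb0 N.
have E b : W (upd h N b) N = W h N.
  by apply: Wpath_depends => i iN; rewrite /upd ltn_eqF.
rewrite /step pwhiteE /= !E /upd eqxx addr0.
have -> : (W h N + sigma) / sigma = W h N / sigma + 1 by field; rewrite gt_eqF.
set x := W h N / sigma.
have -> : W h N = x * sigma by rewrite /x divfK// gt_eqF.
have -> : x * sigma / T N * rising (x + 1) s = sigma / T N * (x * rising (x + 1) s) by
  ring.
by rewrite rising_shift; field; rewrite gt_eqF.
Qed.

Lemma cexp_rising N s :
  cexp pwhite N 0 (fun h => rising (W h N / sigma) s) xpred0 =
  rising (w0 / sigma) s * \prod_(j < N) ((T j + s%:R * sigma) / T j).
Proof.
elim: N => [|N IH]; first by rewrite big_ord0 mulr1.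
rewrite cexpSr addn0 (funext (step_rising N s)) cexpZ IH big_ord_recr /=.
by rewrite [RHS]mulrCA mulrC; ring.
Qed.

(** The series is taken path by path, where the exponent is positive; [falling_lah] then turns each
    term into rising factorials, whose means [cexp_rising] gives. *)
Lemma binomial_moments N (v : R) : `|v - 1| < 1 ->
  (fun n : nat => \sum_(s < n)
          ((v - 1) ^+ s / s`!%:R *
           \sum_(r < s.+1) ((-1) ^+ (s - r) * lah s r * rising (w0 / sigma) r *
                            \prod_(j < N) ((T j + r%:R * sigma) / T j))))
         @ \oo --> cexp pwhite N 0 (fun h => v `^ (W h N / sigma)) xpred0.
Proof.
move=> v1.
pose F n h := \sum_(s < n) binc (W h N / sigma) s * (v - 1) ^+ s.
have cF h : F n h @[n --> \oo] --> v `^ (W h N / sigma).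
  have := binomial_series (W h N / sigma) (v - 1) (divr_gt0 (Wpath_gt0 h N) hsigma) v1.
  by rewrite [1 + _]addrC subrK.
have H := cexp_cvg pwhite N 0 F _ xpred0 cF.
rewrite [X in X @ _](_ : _ = (fun n => cexp pwhite N 0 (F n) xpred0)); first exact: H.
apply/funext => n; symmetry.
rewrite (cexp_sum pwhite N 0 n (fun s h => binc (W h N / sigma) s * (v - 1) ^+ s)).
apply: eq_bigr => s _.
transitivity (cexp pwhite N 0 (fun h => (v - 1) ^+ s / s`!%:R *
  \sum_(r < s.+1) ((-1) ^+ (s - r) * lah s r * rising (W h N / sigma) r)) xpred0).
  congr cexp; apply/funext => h; rewrite /binc falling_lah.
  by ring.
rewrite cexpZ (cexp_sum pwhite N 0 s.+1
  (fun r h => (-1) ^+ (s - r) * lah s r * rising (W h N / sigma) r)).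
congr (_ * _); apply: eq_bigr => r _.
by rewrite cexpZ cexp_rising mulrA.
Qed.

Definition mart (N : nat) (h : nat -> bool) : R := g N * W h N.

Lemma mart_depends N : depends N (mart N).
Proof. by move=> h h' hh'; rewrite /mart (Wpath_depends N h h'). Qed.

Lemma step_mart N h : step pwhite N (mart N.+1) h = mart N h.
Proof.
have T0 := Ttot_gt0 p sigma ell w0 b0 hsigma hell hw0 hb0 N.
have r1 (x : R) : rising x 1 = x by rewrite /rising big_ord1 addr0.
have := step_rising N 1 h; rewrite /step !r1 /mart gNS mul1r => E.
transitivity (g N * (T N / (T N + sigma)) * sigma *
  (pwhite N h * (W (upd h N true) N.+1 / sigma) +
   (1 - pwhite N h) * (W (upd h N false) N.+1 / sigma))).
  by field; rewrite !gt_eqF// addr_gt0.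
by rewrite E; field; rewrite !gt_eqF// addr_gt0.
Qed.

(** A square is at most the corresponding [rising] of order 2, whose mean is explicit. Against
    [g N ^+ 2] its growth factors become [T (T + 2 sigma) / (T + sigma)^2], each at most 1. *)
Lemma mart_square_bounded N :
  cexp pwhite N 0 (fun h => mart N h ^+ 2) xpred0 <=
  sigma ^+ 2 * rising (w0 / sigma) 2.
Proof.
have -> : sigma ^+ 2 * rising (w0 / sigma) 2 = sigma ^+ 2 * rising (w0 / sigma) 2 * 1.
  by rewrite mulr1.
have r2 (x : R) : rising x 2 = x * (x + 1).
  by rewrite /rising big_ord_recl big_ord1 addr0.
apply: (@le_trans _ _ (cexp pwhite N 0
   (fun h => g N ^+ 2 * sigma ^+ 2 * rising (W h N / sigma) 2) xpred0)).
  apply: cexp_le => [|h]; first exact: pwhite_ge0_le1.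
  have x0 : 0 <= W h N / sigma by rewrite ltW// divr_gt0// Wpath_gt0.
  rewrite /mart r2; have {1}-> : W h N = W h N / sigma * sigma by rewrite divfK// gt_eqF.
  set x := _ / _ in x0 *.
  rewrite (_ : (g N * (x * sigma)) ^+ 2 = g N ^+ 2 * sigma ^+ 2 * x ^+ 2); last by ring.
  rewrite ler_wpM2l//; last by rewrite mulrDr mulr1 expr2 lerDl.
  by rewrite -exprMn sqr_ge0.
rewrite cexpZ cexp_rising.
have -> : forall a b c d : R, a * b * (c * d) = b * c * (a * d) by move=> *; ring.
rewrite ler_wpM2l//.
  have x0 : 0 < w0 / sigma by exact: divr_gt0.
  by rewrite r2 ltW// mulr_gt0 ?exprn_gt0// mulr_gt0// addr_gt0.
rewrite /gN -prodrXl -big_split /=; apply: prodr_ile1 => j _.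
have T0 := Ttot_gt0 p sigma ell w0 b0 hsigma hell hw0 hb0 j.
set t := T j in T0 *.
have -> : (t / (t + sigma)) ^+ 2 * ((t + 2%:R * sigma) / t) =
    t * (t + 2%:R * sigma) / (t + sigma) ^+ 2.
  by field; rewrite !gt_eqF// addr_gt0.
have ts : 0 < (t + sigma) ^+ 2 by rewrite exprn_gt0// addr_gt0.
apply/andP; split.
  by rewrite ltW// divr_gt0// mulr_gt0// addr_gt0// mulr_gt0.
by rewrite ler_pdivrMr// mul1r; nra.
Qed.

End urn.

Theorem theorem1 (R : realType) (p : nat) (sigma ell w0 b0 : R)
  (d : measure_display) (Omega : measurableType d) (P : probability Omega R)
  (X : nat -> Omega -> bool)
  (hp : (0 < p)%N) (hsigma : 0 < sigma) (hell : 0 < ell)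
  (hw0 : 0 < w0) (hb0 : 0 <= b0)
  (hX : forall n, measurable_fun setT (X n))
  (hlaw : forall (N : nat) (h : nat -> bool),
     P (history X N h `&` [set w | X N w = true]) =
     (P (history X N h) *
      (Wpath sigma w0 h N / (Wpath sigma w0 h N + Bpath p sigma ell b0 h N))%:E)%E) :
  let W := fun (N : nat) (w : Omega) => Wpath sigma w0 (fun i => X i w) N in
  let T := Ttot p sigma ell w0 b0 in
  let M := fun (N : nat) (w : Omega) => gN p sigma ell w0 b0 N * W N w in
  (* (i) *)
  (forall (N s : nat),
     (\int[P]_w (rising (W N w / sigma) s)%:E)%E =
     (rising (w0 / sigma) s * \prod_(j < N) ((T j + s%:R * sigma) / T j))%:E)
  (* (ii) *)
  /\ (forall (N : nat) (v : R), `|v - 1| < 1 ->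
     exists2 e : R,
       (\int[P]_w (powR v (W N w / sigma))%:E)%E = e%:E &
       (fun n : nat => \sum_(s < n)
          ((v - 1) ^+ s / s`!%:R *
           \sum_(r < s.+1) ((-1) ^+ (s - r) * lah s r * rising (w0 / sigma) r *
                            \prod_(j < N) ((T j + r%:R * sigma) / T j))))
         @ \oo --> e)
  (* (iii) *)
  /\ ((fun N : nat => gN p sigma ell w0 b0 N * powR N%:R (Lambda p sigma ell))
        @ \oo --> kappa p sigma ell w0 b0)
  (* (iv) *)
  /\ ((forall N w, 0 <= M N w)
      /\ (forall N, P.-integrable setT (EFin \o M N))
      /\ (forall N (B : set R), measurable B -> Fdraws X N (M N @^-1` B))
      /\ (forall N (A : set Omega), Fdraws X N A ->
            (\int[P]_(w in A) (M N.+1 w)%:E)%E = (\int[P]_(w in A) (M N w)%:E)%E)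
      /\ exists Minf : Omega -> R,
           measurable_fun setT Minf
           /\ {ae P, forall w, M ^~ w @ \oo --> Minf w}
           /\ {ae P, forall w, (fun N : nat => W N w / powR N%:R (Lambda p sigma ell))
                                 @ \oo --> Minf w / kappa p sigma ell w0 b0}).
Proof.
move=> W T M.
have Eint := integral_path P X hX (pwhite p sigma ell w0 b0) hlaw.
have dW := Wpath_depends sigma w0.
have dM := mart_depends p sigma ell w0 b0.
have g0 N := gN_gt0 p sigma ell w0 b0 hsigma hell hw0 hb0 N.
split; [|split; [|split; [|split; [|split; [|split; [|split]]]]]].
- move=> N s.
  rewrite (Eint N (fun h => rising (Wpath sigma w0 h N / sigma) s)).
    by rewrite cexp_rising.
  by move=> h h' hh'; rewrite (dW N h h').
- move=> N v v1; eexists; last exact: binomial_moments.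
  rewrite (Eint N (fun h => v `^ (Wpath sigma w0 h N / sigma)))//.
  by move=> h h' hh'; rewrite (dW N h h').
- exact: gN_cvg.
- by move=> N w; rewrite mulr_ge0// ltW// Wpath_gt0.
- by move=> N; exact: (integrable_path P X hX setT measurableT (dM N)).
- move=> N B _; apply: (depends_Fdraws X N (fun h => B (mart p sigma ell w0 b0 N h))).
  by move=> h h' hh'; rewrite (dM N h h').
- move=> N A /[dup] /(Fdraws_measurable X hX) mA /(Fdraws_depends X)[a da AE].
  (* The event as a 0-1 path functional: it ignores draw [N], so it factors out of [step] and the
     martingale identity applies. *)
  pose ind h : R := (asbool (a h))%:R.
  have dind : depends N ind by move=> h h' hh'; rewrite /ind (da h h').
  have indE n : (\int[P]_(w in A) (M n w)%:E)%E =
      (\int[P]_w (ind (X ^~ w) * mart p sigma ell w0 b0 n (X ^~ w))%:E)%E.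
    rewrite integral_mkcond; apply: eq_integral => w _; rewrite patchE /ind.
    suff -> : (w \in A) = asbool (a (X ^~ w)) by case: asbool; rewrite ?mul1r ?mul0r.
    by apply/idP/asboolP; rewrite inE AE.
  rewrite !indE.
  rewrite (Eint N.+1 (fun h => ind h * mart p sigma ell w0 b0 N.+1 h)); last first.
    move=> h h' hh'; rewrite (dM N.+1 h h')// (dind h h')// => i iN.
    by apply: hh'; exact: ltnW.
  rewrite (Eint N (fun h => ind h * mart p sigma ell w0 b0 N h)); last first.
    by move=> h h' hh'; rewrite (dM N h h')// (dind h h').
  rewrite cexpSr addn0; congr ((cexp _ _ _ _ _)%:E); apply/funext => h.
  rewrite -step_mart// /step.
  have Ei b : ind (upd h N b) = ind h by apply: dind => i iN; rewrite /upd ltn_eqF.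
  by rewrite !Ei; ring.
have cvM : {ae P, forall w, cvgn (M ^~ w)}.
  apply: (square_bounded_martingale_cvg P X hX (pwhite p sigma ell w0 b0) hlaw
    (pwhite_ge0_le1 p sigma ell w0 b0 hsigma hell hw0 hb0) _ dM
    (step_mart p sigma ell w0 b0 hp hsigma hell hw0 hb0)).
  exact: mart_square_bounded.
(* A limit superior is defined and measurable on all outcomes; where it is infinite, [fine] returns
   0. *)
pose Minf w := fine (limn_esup (fun n => (M n w)%:E)).
have MinfE w : cvgn (M ^~ w) -> M ^~ w @ \oo --> Minf w.
  move=> /cvg_ex[l cl]; suff -> : Minf w = l by [].
  have : (M n w)%:E @[n --> \oo] --> l%:E by apply/cvg_EFin => //; exact: nearW.
  by rewrite /Minf => /cvg_limn_einf_sup ->.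
exists Minf; split; [|split].
- apply: (measurableT_comp (fine_measurable measurableT)).
  apply: measurable_fun_limn_esup => n; apply/measurable_EFinP.
  exact: (measurable_path X hX (dM n)).
- by apply: filterS cvM => w; exact: MinfE.
- apply: filterS cvM => w /MinfE cM.
  have k0 : kappa p sigma ell w0 b0 != 0 by rewrite gt_eqF// kappa_gt0.
  have H := cvgM cM (cvgV k0 (gN_cvg p sigma ell w0 b0 hp hsigma hell hw0 hb0)).
  rewrite [X in X @ _](_ : _ = (fun N => M N w *
    (gN p sigma ell w0 b0 N * N%:R `^ Lambda p sigma ell)^-1)).
    exact: H.
  (* Only [g] is cancelled, so the identity also holds at [N = 0], where the power of [N] and its
     inverse are 0. *)
  apply/funext => N; symmetry; rewrite /M.
  by rewrite invfM mulrACA mulfV ?mul1r// gt_eqF.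
Qed.
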